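(* \textsc{Path Discovery} and \textsc{Shortest Path Discovery} (in the directed weighted two-graph model) are fixed-parameter tractable when parameterized by the number $k=|S|$ of tokens.
   Context: Two-graph model. An instance is $(G,M,s,t,S,b)$ where $G$ (the problem graph) is a directed graph with integer edge weights $w_G\colon E(G)\to\mathbb Z$ and no negative-weight cycle, $M$ (the movement graph) is a directed graph on the same vertex set $V$ with nonnegative integer edge weights $w_M\colon E(M)\to\mathbb Z_{\ge 0}$, $s,t\in V$ are distinct, $S$ is a multiset of vertices (the initial token configuration; $k=|S|$ is the number of tokens), and $b\in\mathbb Z$ is the budget. A move takes a token at a vertex $x$ and an edge $(x,y)\in E(M)$ and relocates that token to $y$, at cost $w_M(x,y)$. A configuration $T$ (multiset) is reachable from $S$ within budget $b$ if there is a sequence of moves transforming $S$ into $T$ of total cost at most $b$. An $s$-$t$ path is a sequence of pairwise distinct vertices $s=v_0,\dots,v_\ell=t$ with $(v_{i-1},v_i)\in E(G)$; its weight is the sum of $w_G$ over its edges; a shortest $s$-$t$ path is one of minimum weight. \textsc{Path Discovery} asks whether some configuration $T$ reachable from $S$ within budget $b$ contains (as a set) the vertex set of some $s$-$t$ path of $G$; \textsc{Shortest Path Discovery} asks the same with a shortest $s$-$t$ path of $G$. (Unused tokens may be ignored; tokens may share a vertex.) *)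

(* Defs.v *)
From mathcomp Require Import all_boot all_order all_algebra.
From mathcomp Require Import finmap multiset.

Set Implicit Arguments.
Unset Strict Implicit.
Unset Printing Implicit Defensive.

Import Order.TTheory GRing.Theory Num.Theory.
Local Open Scope ring_scope.

(******************************************************************************)
(* Machine model: a random access machine with cells indexed by int and       *)
(* holding int, programmed with structured commands, under the logarithmic    *)
(* cost criterion.                                                            *)
(******************************************************************************)

Definition memory := int -> int.

Definition store (m : memory) (a v : int) : memory :=
  fun a' => if a' == a then v else m a'.

Inductive expr :=
| Cst of int
| Get of expr
| Add of expr & expr
| Sub of expr & expr
| Mul of expr & expr.

Inductive cmd :=
| Skip
| Assign of expr & expr
| Seq of cmd & cmd
| If of expr & cmd & cmd
| While of expr & cmd.

Fixpoint eval (m : memory) (e : expr) : int :=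
  match e with
  | Cst z => z
  | Get e1 => m (eval m e1)
  | Add e1 e2 => eval m e1 + eval m e2
  | Sub e1 e2 => eval m e1 - eval m e2
  | Mul e1 e2 => eval m e1 * eval m e2
  end.

(* Number of binary digits of the absolute value, plus one for the sign. *)
Definition bitlen (z : int) : nat := (up_log 2 (absz z).+1).+1.

(* Every node is charged the length of its value.  The operands of a node are *)
(* nodes themselves, so an access pays for both the address and the content,  *)
(* and an arithmetic operation for both operands and the result.              *)
Fixpoint cost (m : memory) (e : expr) : nat :=
  (bitlen (eval m e) +
   match e with
   | Cst _ => 0
   | Get e1 => cost m e1
   | Add e1 e2 | Sub e1 e2 | Mul e1 e2 => cost m e1 + cost m e2
   end)%N.

(* [exec c m m' t]: started in m, the command c halts in m' after time t.     *)
(* Tests succeed on strictly positive values.  The rules are deterministic,   *)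
(* so each c and m admit at most one pair m', t.                              *)
Inductive exec : cmd -> memory -> memory -> nat -> Prop :=
| exec_skip m : exec Skip m m 1
| exec_assign m e1 e2 :
    exec (Assign e1 e2) m (store m (eval m e1) (eval m e2))
         (cost m e1 + cost m e2).+1
| exec_seq m1 m2 m3 c1 c2 t1 t2 :
    exec c1 m1 m2 t1 -> exec c2 m2 m3 t2 -> exec (Seq c1 c2) m1 m3 (t1 + t2)
| exec_if_true m m' e c1 c2 t :
    0 < eval m e -> exec c1 m m' t -> exec (If e c1 c2) m m' (cost m e + t).+1
| exec_if_false m m' e c1 c2 t :
    eval m e <= 0 -> exec c2 m m' t -> exec (If e c1 c2) m m' (cost m e + t).+1
| exec_while_true m1 m2 m3 e c t1 t2 :
    0 < eval m1 e -> exec c m1 m2 t1 -> exec (While e c) m2 m3 t2 ->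
    exec (While e c) m1 m3 (cost m1 e + t1 + t2).+1
| exec_while_false m e c :
    eval m e <= 0 -> exec (While e c) m m (cost m e).+1.

(* The input x is preceded by its length, in cell 0; all cells other than     *)
(* 0, ..., size x start at 0.  The output is read in cell 0.                  *)
Definition load (x : seq int) : memory :=
  fun a => if a is Posz i then nth 0 ((size x)%:Z :: x) i else 0.

Definition input_size (x : seq int) : nat := (\sum_(z <- x) bitlen z)%N.

Definition computable (f : nat -> nat) : Prop :=
  exists c : cmd, forall k : nat, exists (m : memory) (t : nat),
    exec c (load [:: k%:Z]) m t /\ m 0 = (f k)%:Z.

Record param_problem := ParamProblem {
  pinstance : Type;
  encode : pinstance -> seq int;
  parameter : pinstance -> nat;
  yes : pinstance -> Prop
}.

(* Inputs that do not encode an instance are not constrained.                 *)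
Definition fpt (P : param_problem) : Prop :=
  exists (c : cmd) (f : nat -> nat) (d : nat),
    computable f /\
    forall I : pinstance P, exists (m : memory) (t : nat),
      [/\ exec c (load (encode I)) m t,
          yes I -> m 0 = 1,
          ~ yes I -> m 0 = 0
        & (t <= f (parameter I) * input_size (encode I) ^ d)%N].

(* The value of [weight] is meaningful on edges only. *)
Record wdigraph (n : nat) := WDigraph {
  edge : rel 'I_n;
  weight : 'I_n -> 'I_n -> int
}.

Section Graphs.
Context {n : nat}.
Implicit Types (G M : wdigraph n) (S T : {mset 'I_n}%mset).

(* Weight of the walk x :: p. *)
Definition walk_weight G (x : 'I_n) (p : seq 'I_n) : int :=
  \sum_(w <- pairmap (weight G) x p) w.

Definition no_negative_cycle G : Prop :=
  forall (x : 'I_n) (p : seq 'I_n),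
    ucycle (edge G) (x :: p) -> 0 <= walk_weight G x (rcons p x).

(* s :: p is an s-t path. *)
Definition is_path G (s t : 'I_n) (p : seq 'I_n) : Prop :=
  [/\ path (edge G) s p, last s p = t & uniq (s :: p)].

Definition is_shortest_path G (s t : 'I_n) (p : seq 'I_n) : Prop :=
  is_path G s t p /\
  forall q, is_path G s t q -> walk_weight G s p <= walk_weight G s q.

(* [moves M S T c]: some sequence of moves of total cost c turns S into T. *)
Inductive moves M : {mset 'I_n}%mset -> {mset 'I_n}%mset -> int -> Prop :=
| moves_nil S : moves M S S 0
| moves_cons S T (x y : 'I_n) c :
    x \in S -> edge M x y -> moves M (y +` (S `\ x))%mset T c ->
    moves M S T (weight M x y + c).

Definition reachable M S (b : int) T : Prop :=
  exists2 c : int, moves M S T c & c <= b.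

End Graphs.

Record instance := Instance {
  nvertices : nat;
  Ggraph : wdigraph nvertices;
  Mgraph : wdigraph nvertices;
  source : 'I_nvertices;
  target : 'I_nvertices;
  tokens : {mset 'I_nvertices}%mset;
  budget : int;
  Ggraph_no_negative_cycle : no_negative_cycle Ggraph;
  Mgraph_weight_ge0 : forall x y, edge Mgraph x y -> 0 <= weight Mgraph x y;
  source_neq_target : source != target
}.

Definition ntokens (I : instance) : nat := size (tokens I).

(* Adjacency matrix in row-major order; the entry of a pair of vertices is    *)
(* two integers, 1 and the weight for an edge, 0 and 0 otherwise.             *)
Definition encode_graph n (G : wdigraph n) : seq int :=
  flatten [seq (if edge G x y then [:: 1; weight G x y] else [:: 0; 0])
          | x <- enum 'I_n, y <- enum 'I_n].

Definition encode_instance (I : instance) : seq int :=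
  [:: (nvertices I)%:Z; (source I : nat)%:Z; (target I : nat)%:Z; budget I;
      (ntokens I)%:Z]
  ++ [seq (nat_of_ord x)%:Z | x <- tokens I]
  ++ encode_graph (Ggraph I) ++ encode_graph (Mgraph I).

Definition path_discovery : param_problem :=
  {| pinstance := instance;
     encode := encode_instance;
     parameter := ntokens;
     yes := fun I => exists T p,
       [/\ reachable (Mgraph I) (tokens I) (budget I) T,
           is_path (Ggraph I) (source I) (target I) p
         & {subset source I :: p <= T}] |}.

Definition shortest_path_discovery : param_problem :=
  {| pinstance := instance;
     encode := encode_instance;
     parameter := ntokens;
     yes := fun I => exists T p,
       [/\ reachable (Mgraph I) (tokens I) (budget I) T,
           is_shortest_path (Ggraph I) (source I) (target I) p
         & {subset source I :: p <= T}] |}.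

(* Main.v *)
From mathcomp Require Import all_boot all_order all_algebra.
From mathcomp Require Import finmap multiset zify ring.
Require Import Defs.

(* Only walks matter, not paths: removing cycles from an s-t walk that is     *)
(* covered by tokens leaves a path that is covered by the same tokens and is  *)
(* not heavier.  Hence a dynamic program over states (X, v, x) suffices,      *)
(* where X is the set of tokens used so far, v the end of the current walk    *)
(* from s, and x the current position of the token moving towards v.  A       *)
(* shortest path is exactly a path whose edges (u, v) are tight, i.e. satisfy *)
(* dist(s, u) + w(u, v) = dist(s, v), so both the distances in G and the      *)
(* cheapest state reached are computed by the same Bellman-Ford procedure, on *)
(* G and on the 2^k n (n + 1) states.  Path Discovery is the case of zero     *)
(* weights.                                                                   *)
(*   As products occur in addresses only, each step of the program lengthens  *)
(* the stored integers by O(1) bits, so that the logarithmic cost is at most  *)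
(* quadratic in the number of steps, times the input size.                    *)

Set Implicit Arguments.
Unset Strict Implicit.
Unset Printing Implicit Defensive.

Import Order.TTheory GRing.Theory Num.Theory.
Local Open Scope ring_scope.

(** * Logarithmic cost from the number of steps *)

(** Correctness. The cost of a sequence of moves is the sum of the costs of the walks of the single
    tokens ([moves_tokens]). Weights telescope along a tight walk, so that cutting off cycles, which
    have nonnegative weight ([walk_shorten]), leaves a shortest path covered by the same tokens.
    Conversely, a shortest path is tight ([tight_of_shortest]); if it is covered, the tokens chosen
    for its vertices are distinct because the vertices are ([vertex_walk_complete]), and the other
    tokens contribute a nonnegative cost. Hence the answer is yes iff for some X the distance to (X,
    t, t) is at most b ([answerP]). The distances are found by Bellman-Ford: every entry is the
    weight of a walk ([rounds_walk]), and after as many rounds as there are vertices no walk is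
    lighter than the entry of its end ([rounds_below]).

    Time. The program is verified with triples that also count unit steps ([uexec_program]). For
    input size Z, each loop makes at most X = 2^k Z iterations, so that there are O(X^e) steps,
    where e is the nesting depth ([step_bound_leq]). By [uexec_exec] the logarithmic cost is O(X^e
    (Z + X^e)), which [fpt_answer] bounds by f(k) Z^(2e+1). *)

Lemma bitlen_leq z n : (absz z < 2 ^ n)%N -> (bitlen z <= n.+1)%N.
Proof. by move=> h; rewrite /bitlen ltnS up_log_min. Qed.

Lemma ltn_bitlen z : (absz z < 2 ^ (bitlen z).-1)%N.
Proof. exact: up_logP. Qed.

Lemma bitlen_gt0 z : (0 < bitlen z)%N.
Proof. by []. Qed.

Lemma bitlenD x y : (bitlen (x + y) <= (maxn (bitlen x) (bitlen y)).+1)%N.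
Proof.
have e : (maxn (bitlen x) (bitlen y) = (maxn (bitlen x).-1 (bitlen y).-1).+1)%N.
  by rewrite -[bitlen x]prednK // -[bitlen y]prednK // maxnSS.
rewrite e; apply: bitlen_leq; rewrite expnS mul2n -addnn.
have hx := ltn_bitlen x; have hy := ltn_bitlen y.
set m := maxn _ _.
have : (2 ^ (bitlen x).-1 <= 2 ^ m)%N by rewrite leq_exp2l // leq_maxl.
have : (2 ^ (bitlen y).-1 <= 2 ^ m)%N by rewrite leq_exp2l // leq_maxr.
lia.
Qed.

Lemma bitlenN x : bitlen (- x) = bitlen x.
Proof. by rewrite /bitlen abszN. Qed.

Lemma bitlenM x y : (bitlen (x * y) <= bitlen x + bitlen y)%N.
Proof.
have -> : (bitlen x + bitlen y = ((bitlen x).-1 + (bitlen y).-1).+2)%N.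
  by rewrite -{1}[bitlen x]prednK // -{1}[bitlen y]prednK // addSn addnS.
apply: leqW; apply: bitlen_leq; rewrite abszM expnD.
have hx := ltn_bitlen x; have hy := ltn_bitlen y.
exact: ltn_mul.
Qed.

Lemma bitlen_nat n : (bitlen n%:Z <= n.+1)%N.
Proof. by apply: bitlen_leq => /=; apply: ltn_expl. Qed.

(** Over a memory of L-bit cells this one size gives a multiplicative bound on the length of any
    value ([bitlen_eval]) and an additive one for linear expressions ([bitlen_eval_linear]). *)
Fixpoint esize (e : expr) : nat :=
  match e with
  | Cst z => bitlen z
  | Get e1 => (esize e1).+1
  | Add e1 e2 | Sub e1 e2 | Mul e1 e2 => (esize e1 + esize e2).+1
  end.

Fixpoint ecost (e : expr) : nat :=
  (esize e +
   match e with
   | Cst _ => 0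
   | Get e1 => ecost e1
   | Add e1 e2 | Sub e1 e2 | Mul e1 e2 => ecost e1 + ecost e2
   end)%N.

(* Products are allowed in addresses only, so that stored values grow by at   *)
(* most [esize e] bits.                                                       *)
Fixpoint linear (e : expr) : bool :=
  match e with
  | Cst _ | Get _ => true
  | Add e1 e2 | Sub e1 e2 => linear e1 && linear e2
  | Mul _ _ => false
  end.

(** A single constant for two purposes: the [ecost] terms bound the cost of a step in units of L,
    and the extra [esize e2] bounds the growth of the stored value. *)
Fixpoint csize (c : cmd) : nat :=
  match c with
  | Skip => 0
  | Assign e1 e2 => ecost e1 + ecost e2 + esize e2
  | Seq c1 c2 => csize c1 + csize c2
  | If e c1 c2 => ecost e + csize c1 + csize c2
  | While e c => ecost e + csize c
  end%N.

Fixpoint clinear (c : cmd) : bool :=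
  match c with
  | Skip => true
  | Assign _ e => linear e
  | Seq c1 c2 | If _ c1 c2 => clinear c1 && clinear c2
  | While _ c => clinear c
  end.

Definition bounded (L : nat) (m : memory) : Prop :=
  forall a, (bitlen (m a) <= L)%N.

Lemma bounded_leq L L' m : (L <= L')%N -> bounded L m -> bounded L' m.
Proof. by move=> h b a; apply: leq_trans h. Qed.

Lemma bitlen_eval L m e :
  (0 < L)%N -> bounded L m -> (bitlen (eval m e) <= esize e * L)%N.
Proof.
move=> L0 bm; elim: e => [z|e _|e1 h1 e2 h2|e1 h1 e2 h2|e1 h1 e2 h2] /=.
- by rewrite leq_pmulr.
- by apply: leq_trans (bm _) _; rewrite leq_pmull.
- by have := bitlenD (eval m e1) (eval m e2); lia.
- by have := bitlenD (eval m e1) (- eval m e2); rewrite bitlenN; lia.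
- by have := bitlenM (eval m e1) (eval m e2); lia.
Qed.

Lemma bitlen_eval_linear L m e :
  bounded L m -> linear e -> (bitlen (eval m e) <= L + esize e)%N.
Proof.
move=> bm; elim: e => [z|e _|e1 h1 e2 h2|e1 h1 e2 h2|e1 h1 e2 h2] //=.
- by rewrite leq_addl.
- by move=> _; apply: leq_trans (bm _) _; rewrite leq_addr.
- case/andP=> /h1 {}h1 /h2 {}h2.
  by have := bitlenD (eval m e1) (eval m e2); lia.
- case/andP=> /h1 {}h1 /h2 {}h2.
  by have := bitlenD (eval m e1) (- eval m e2); rewrite bitlenN; lia.
Qed.

Lemma cost_leq L m e :
  (0 < L)%N -> bounded L m -> (cost m e <= ecost e * L)%N.
Proof.
move=> L0 bm; elim: e => [z|e h|e1 h1 e2 h2|e1 h1 e2 h2|e1 h1 e2 h2] /=.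
- by rewrite !addn0 leq_pmulr.
- have /= := bitlen_eval (Get e) L0 bm; lia.
- have /= := bitlen_eval (Add e1 e2) L0 bm; lia.
- have /= := bitlen_eval (Sub e1 e2) L0 bm; lia.
- have /= := bitlen_eval (Mul e1 e2) L0 bm; lia.
Qed.

(** The semantics of [exec] with unit cost, so that steps can be counted without regard to the
    lengths of integers. *)
Inductive uexec : cmd -> memory -> memory -> nat -> Prop :=
| uexec_skip m : uexec Skip m m 1
| uexec_assign m e1 e2 :
    uexec (Assign e1 e2) m (store m (eval m e1) (eval m e2)) 1
| uexec_seq m1 m2 m3 c1 c2 t1 t2 :
    uexec c1 m1 m2 t1 -> uexec c2 m2 m3 t2 ->
    uexec (Seq c1 c2) m1 m3 (t1 + t2)
| uexec_if_true m m' e c1 c2 t :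
    0 < eval m e -> uexec c1 m m' t -> uexec (If e c1 c2) m m' t.+1
| uexec_if_false m m' e c1 c2 t :
    eval m e <= 0 -> uexec c2 m m' t -> uexec (If e c1 c2) m m' t.+1
| uexec_while_true m1 m2 m3 e c t1 t2 :
    0 < eval m1 e -> uexec c m1 m2 t1 -> uexec (While e c) m2 m3 t2 ->
    uexec (While e c) m1 m3 (t1 + t2).+1
| uexec_while_false m e c :
    eval m e <= 0 -> uexec (While e c) m m 1.

(** Each step lengthens the cells by at most A bits, so all lengths stay below L + A N, and a step
    on cells of length l costs at most (A + 1) l. *)
Lemma uexec_exec c m m' N A L :
  uexec c m m' N -> clinear c -> (csize c <= A)%N -> (0 < L)%N ->
  bounded L m ->
  bounded (L + A * N) m' /\
  exists2 t, exec c m m' t & (t <= N * (A.+1 * (L + A * N)))%N.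
Proof.
move=> run; elim: run L => {c m m' N} /=.
- move=> m L _ _ L0 bm; split; first by apply: bounded_leq bm; lia.
  by exists 1%N; [exact: exec_skip | lia].
- move=> m e1 e2 L lin sz L0 bm; split.
    move=> a; rewrite /store; case: eqP => _.
      by have := bitlen_eval_linear bm lin; lia.
    by have := bm a; lia.
  exists (cost m e1 + cost m e2).+1; first exact: exec_assign.
  have := cost_leq e1 L0 bm; have := cost_leq e2 L0 bm.
  nia.
- move=> m1 m2 m3 c1 c2 N1 N2 _ IH1 _ IH2 L /andP[l1 l2] sz L0 bm.
  have [|bm2 [t1 r1 h1]] := IH1 L l1 _ L0 bm; first by lia.
  have [||bm3 [t2 r2 h2]] := IH2 (L + A * N1)%N l2 _ _ bm2; try by lia.
  split; first by apply: bounded_leq bm3; lia.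
  exists (t1 + t2)%N; first exact: exec_seq r1 r2.
  nia.
- move=> m m' e c1 c2 N e0 _ IH L /andP[l1 l2] sz L0 bm.
  have [|bm2 [t1 r1 h1]] := IH L l1 _ L0 bm; first by lia.
  split; first by apply: bounded_leq bm2; lia.
  exists (cost m e + t1).+1; first exact: exec_if_true.
  have := cost_leq e L0 bm; nia.
- move=> m m' e c1 c2 N e0 _ IH L /andP[l1 l2] sz L0 bm.
  have [|bm2 [t1 r1 h1]] := IH L l2 _ L0 bm; first by lia.
  split; first by apply: bounded_leq bm2; lia.
  exists (cost m e + t1).+1; first exact: exec_if_false.
  have := cost_leq e L0 bm; nia.
- move=> m1 m2 m3 e c N1 N2 e0 _ IH1 _ IH2 L l sz L0 bm.
  have [|bm2 [t1 r1 h1]] := IH1 L l _ L0 bm; first by lia.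
  have [||bm3 [t2 r2 h2]] := IH2 (L + A * N1)%N l _ _ bm2; try by lia.
  split; first by apply: bounded_leq bm3; lia.
  exists (cost m1 e + t1 + t2).+1; first exact: exec_while_true r1 r2.
  have := cost_leq e L0 bm; nia.
- move=> m e c e0 L l sz L0 bm.
  split; first by apply: bounded_leq bm; lia.
  exists (cost m e).+1; first exact: exec_while_false.
  have := cost_leq e L0 bm; nia.
Qed.

(* Bounds the number of unit steps when every loop iterates at most X times. *)
Fixpoint step_bound (X : nat) (c : cmd) : nat :=
  match c with
  | Skip | Assign _ _ => 1
  | Seq c1 c2 => step_bound X c1 + step_bound X c2
  | If _ c1 c2 => (step_bound X c1 + step_bound X c2).+1
  | While _ c => (X * (step_bound X c).+1).+1
  end%N.

Fixpoint depth (c : cmd) : nat :=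
  match c with
  | Skip | Assign _ _ => 0
  | Seq c1 c2 | If _ c1 c2 => maxn (depth c1) (depth c2)
  | While _ c => (depth c).+1
  end%N.

(** For a loop, one of the two extra units pays for the tests of the iterations and the other for
    the final failing test. *)
Fixpoint cmd_size (c : cmd) : nat :=
  match c with
  | Skip | Assign _ _ => 1
  | Seq c1 c2 | If _ c1 c2 => (cmd_size c1 + cmd_size c2).+1
  | While _ c => (cmd_size c).+2
  end%N.

Lemma step_bound_leq X c :
  (0 < X)%N -> (step_bound X c <= cmd_size c * X ^ depth c)%N.
Proof.
move=> X0; elim: c => [|e1 e2|c1 h1 c2 h2|e c1 h1 c2 h2|e c h] /=.
- by rewrite expn0.
- by rewrite expn0.
- have : (X ^ depth c1 <= X ^ maxn (depth c1) (depth c2))%N.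
    by rewrite leq_pexp2l // leq_maxl.
  have : (X ^ depth c2 <= X ^ maxn (depth c1) (depth c2))%N.
    by rewrite leq_pexp2l // leq_maxr.
  nia.
- have : (X ^ depth c1 <= X ^ maxn (depth c1) (depth c2))%N.
    by rewrite leq_pexp2l // leq_maxl.
  have : (X ^ depth c2 <= X ^ maxn (depth c1) (depth c2))%N.
    by rewrite leq_pexp2l // leq_maxr.
  have : (0 < X ^ depth c1)%N by rewrite expn_gt0 X0.
  nia.
- have : (0 < X ^ depth c)%N by rewrite expn_gt0 X0.
  rewrite expnS; nia.
Qed.

(** * Correctness triples *)

(* The negative addresses are split into five interleaved regions: region 0   *)
(* holds the variables, regions 1, 2 and 3, 4 two arrays of optional integers *)
(* (a presence flag and a value).                                             *)
Definition cell (r i : nat) : int := Negz (5 * i + r).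

Lemma cell_eq r i r' i' :
  (r < 5)%N -> (r' < 5)%N -> (cell r i == cell r' i') = (r == r') && (i == i').
Proof.
move=> hr hr'; rewrite /cell; apply/eqP/andP => [[h]|[/eqP-> /eqP->] //].
by split; apply/eqP; lia.
Qed.

Definition flag_region (q : bool) : nat := if q then 3 else 1.
Definition value_region (q : bool) : nat := if q then 4 else 2.

Definition Cell (r : nat) (e : expr) : expr :=
  Sub (Cst (Negz r)) (Mul (Cst 5) e).
Definition Nat (n : nat) : expr := Cst n%:Z.
Definition Var (j : nat) : expr := Get (Cst (cell 0 j)).
Definition Flag (q : bool) (e : expr) : expr := Get (Cell (flag_region q) e).
Definition Value (q : bool) (e : expr) : expr := Get (Cell (value_region q) e).

Definition SetVar (j : nat) (e : expr) : cmd := Assign (Cst (cell 0 j)) e.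
Definition SetEntry (q : bool) (u e : expr) : cmd :=
  Seq (Assign (Cell (value_region q) u) e)
      (Assign (Cell (flag_region q) u) (Cst 1)).
Definition For (j : nat) (e : expr) (c : cmd) : cmd :=
  Seq (SetVar j (Cst 0))
      (While (Sub e (Var j)) (Seq c (SetVar j (Add (Var j) (Cst 1))))).
Definition Relax (q : bool) (u v w : expr) : cmd :=
  If (Flag q u)
     (If (Flag q v)
         (If (Sub (Value q v) (Add (Value q u) w))
             (SetEntry q v (Add (Value q u) w)) Skip)
         (SetEntry q v (Add (Value q u) w)))
     Skip.

(** A table of tentative distances, with [None] for infinity. *)
Definition entries := nat -> option int.

Record state := State { vars : seq int; arr : bool -> entries }.

Definition update (D : entries) (u : nat) (c : int) : entries :=
  fun v => if v == u then Some c else D v.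

Definition relax (D : entries) (t : nat * nat * int) : entries :=
  let: (u, v, w) := t in
  if D u is Some c then
    if D v is Some c' then
      if c + w < c' then update D v (c + w) else D
    else update D v (c + w)
  else D.

(* All arrays but the one with index q are described by O. *)
Definition focus (q : bool) (D O : entries) : bool -> entries :=
  fun q' => if q' == q then D else O.

(** * Total correctness with a bound on the number of steps *)

Section Triples.
Variables (inp : seq int) (X : nat).

(** Values of absent entries and variables beyond [vars s] are left free. Forgetting trailing
    variables is therefore a weakening, which is how loop counters go out of scope. *)
Definition models (s : state) (m : memory) : Prop :=
  [/\ forall i : nat, m i = load inp i,
      forall j, (j < size (vars s))%N -> m (cell 0 j) = (vars s)`_j,
      forall q i, m (cell (flag_region q) i) = (isSome (arr s q i) : nat) &
      forall q i c, arr s q i = Some c -> m (cell (value_region q) i) = c].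

Definition evals (s : state) (e : expr) (z : int) : Prop :=
  forall m, models s m -> eval m e = z.

Definition triple (s : state) (c : cmd) (s' : state) : Prop :=
  forall m, models s m ->
  exists m' N, [/\ uexec c m m' N, (N <= step_bound X c)%N & models s' m'].

Lemma evals_cst s z : evals s (Cst z) z.
Proof. by []. Qed.

Lemma evals_nat s n : evals s (Nat n) n.
Proof. by []. Qed.

Lemma evals_var vs A j : (j < size vs)%N -> evals (State vs A) (Var j) vs`_j.
Proof. by move=> h m [_ hv _ _]; rewrite /= hv. Qed.

Lemma evals_add s e1 e2 z1 z2 :
  evals s e1 z1 -> evals s e2 z2 -> evals s (Add e1 e2) (z1 + z2).
Proof. by move=> h1 h2 m hm /=; rewrite h1 // h2. Qed.

Lemma evals_sub s e1 e2 z1 z2 :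
  evals s e1 z1 -> evals s e2 z2 -> evals s (Sub e1 e2) (z1 - z2).
Proof. by move=> h1 h2 m hm /=; rewrite h1 // h2. Qed.

Lemma evals_mul s e1 e2 z1 z2 :
  evals s e1 z1 -> evals s e2 z2 -> evals s (Mul e1 e2) (z1 * z2).
Proof. by move=> h1 h2 m hm /=; rewrite h1 // h2. Qed.

Lemma evals_addn s e1 e2 (n1 n2 : nat) :
  evals s e1 n1 -> evals s e2 n2 -> evals s (Add e1 e2) (n1 + n2)%N.
Proof. by move=> h1 h2; rewrite PoszD; apply: evals_add. Qed.

Lemma evals_muln s e1 e2 (n1 n2 : nat) :
  evals s e1 n1 -> evals s e2 n2 -> evals s (Mul e1 e2) (n1 * n2)%N.
Proof. by move=> h1 h2; rewrite PoszM; apply: evals_mul. Qed.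

Lemma evals_input s e (i : nat) : evals s e i -> evals s (Get e) (load inp i).
Proof. by move=> h m hm /=; rewrite h //; case: hm => ->. Qed.

Lemma evals_cell s r e (i : nat) : evals s e i -> evals s (Cell r e) (cell r i).
Proof. by move=> h m hm /=; rewrite h // /cell !NegzE; lia. Qed.

Lemma evals_flag vs A q e (i : nat) :
  evals (State vs A) e i ->
  evals (State vs A) (Flag q e) (isSome (A q i) : nat).
Proof.
move=> h m hm; rewrite -[eval m _]/(m (eval m (Cell (flag_region q) e))).
rewrite (evals_cell _ h hm).
by case: hm => _ _ ->.
Qed.

Lemma evals_value vs A q e (i : nat) c :
  evals (State vs A) e i -> A q i = Some c ->
  evals (State vs A) (Value q e) c.
Proof.
move=> h hc m hm; rewrite -[eval m _]/(m (eval m (Cell (value_region q) e))).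
rewrite (evals_cell _ h hm).
by case: hm => _ _ _; apply.
Qed.

Lemma triple_skip s : triple s Skip s.
Proof. by move=> m hm; exists m, 1%N; split; [exact: uexec_skip| |]. Qed.

Lemma triple_seq s1 s2 s3 c1 c2 :
  triple s1 c1 s2 -> triple s2 c2 s3 -> triple s1 (Seq c1 c2) s3.
Proof.
move=> h1 h2 m1 /h1[m2 [N1 [r1 b1 /h2[m3 [N2 [r2 b2 hm3]]]]]].
exists m3, (N1 + N2)%N; split=> //; first exact: uexec_seq r1 r2.
by rewrite /= leq_add.
Qed.

Lemma triple_if s s' e z c1 c2 :
  evals s e z -> (0 < z -> triple s c1 s') -> (z <= 0 -> triple s c2 s') ->
  triple s (If e c1 c2) s'.
Proof.
move=> he h1 h2 m hm; have ez := he m hm.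
case: (ltrP 0 z) => hz.
  have [m' [N [r b hm']]] := h1 hz m hm.
  exists m', N.+1; split=> //; last by rewrite /=; lia.
  by apply: uexec_if_true => //; rewrite ez.
have [m' [N [r b hm']]] := h2 hz m hm.
exists m', N.+1; split=> //; last by rewrite /=; lia.
by apply: uexec_if_false => //; rewrite ez.
Qed.

Lemma triple_conseq s1 s2 s1' s2' c :
  (forall m, models s1' m -> models s1 m) ->
  (forall m, models s2 m -> models s2' m) ->
  triple s1 c s2 -> triple s1' c s2'.
Proof.
by move=> h h' t m /h/t[m' [N [r b /h' hm']]]; exists m', N.
Qed.

Lemma models_prefix vs ws A m :
  models (State (vs ++ ws) A) m -> models (State vs A) m.
Proof.
case=> hi hv hf hd; split=> //= j hj.
by rewrite hv /= ?nth_cat ?hj // size_cat ltn_addr.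
Qed.

Lemma models_rcons vs z A m :
  models (State (rcons vs z) A) m -> models (State vs A) m.
Proof. by rewrite -cats1; apply: models_prefix. Qed.

Lemma models_eq_arr vs A A' m :
  (forall q, A q =1 A' q) -> models (State vs A) m -> models (State vs A') m.
Proof.
move=> e [hi hv hf hd]; split=> //= q i; first by rewrite hf /= e.
by move=> c hc; apply: hd; rewrite /= e.
Qed.

Lemma store_Posz m r i z (j : nat) : store m (cell r i) z j = m j.
Proof. by []. Qed.

Lemma store_cell m r i z r' i' :
  (r < 5)%N -> (r' < 5)%N ->
  store m (cell r i) z (cell r' i') =
  if (r' == r) && (i' == i) then z else m (cell r' i').
Proof. by move=> hr hr'; rewrite /store cell_eq. Qed.

Lemma flag_region_lt5 q : (flag_region q < 5)%N. Proof. by case: q. Qed.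
Lemma value_region_lt5 q : (value_region q < 5)%N. Proof. by case: q. Qed.

Lemma triple_setvar vs A j e z :
  (j <= size vs)%N -> evals (State vs A) e z ->
  triple (State vs A) (SetVar j e) (State (set_nth 0 vs j z) A).
Proof.
move=> hj he m hm.
exists (store m (cell 0 j) z), 1%N; split=> //.
  by rewrite -(he m hm); apply: uexec_assign.
case: hm => hi hv hf hd; split=> /=.
- by move=> i; rewrite store_Posz.
- move=> i; rewrite size_set_nth store_cell //= nth_set_nth /= => hi'.
  by case: eqP => // ne; apply: hv => /=; lia.
- by move=> q i; rewrite store_cell ?flag_region_lt5 // -hf; case: q.
- move=> q i c /hd; rewrite store_cell ?value_region_lt5 // => <-.
  by case: q.
Qed.

Lemma triple_newvar vs A e z :
  evals (State vs A) e z ->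
  triple (State vs A) (SetVar (size vs) e) (State (rcons vs z) A).
Proof.
move=> he; have := triple_setvar (leqnn _) he.
suff -> : set_nth 0 vs (size vs) z = rcons vs z by [].
by elim: vs {he} => //= x vs ->.
Qed.

(** The invariant is a family of states indexed by the counter, which lives in the first free
    variable d. The bound e is evaluated anew at each test and has to keep its value n. *)
Lemma triple_for (vs : nat -> seq int) (A : nat -> bool -> entries) d e c n :
  (n <= X)%N -> (forall i, size (vs i) = d) ->
  (forall i, (i <= n)%N -> evals (State (rcons (vs i) i%:Z) (A i)) e n) ->
  (forall i, (i < n)%N -> triple (State (rcons (vs i) i%:Z) (A i)) c
                               (State (rcons (vs i.+1) i%:Z) (A i.+1))) ->
  triple (State (vs 0%N) (A 0%N)) (For d e c) (State (vs n) (A n)).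
Proof.
move=> hX hd he hc.
pose body := Seq c (SetVar d (Add (Var d) (Cst 1))).
have ev i (a : nat) A' : evals (State (rcons (vs i) a%:Z) A') (Var d) a.
  move=> m hm; rewrite (evals_var _ hm) ?size_rcons ?hd //.
  by rewrite nth_rcons hd ltnn eqxx.
have hbody i : (i < n)%N ->
    triple (State (rcons (vs i) i%:Z) (A i)) body
           (State (rcons (vs i.+1) i.+1%:Z) (A i.+1)).
  move=> hi; apply: triple_seq (hc i hi) _.
  have -> : rcons (vs i.+1) i.+1%:Z
            = set_nth 0 (rcons (vs i.+1) i%:Z) d i.+1%:Z.
    by rewrite -(hd i.+1); elim: (vs i.+1) => //= x s ->.
  apply: triple_setvar; first by rewrite size_rcons hd.
  by rewrite -addn1; apply: evals_addn; [exact: ev|].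
(* Induction on the number k of iterations left. *)
have hloop k i m : (i + k = n)%N -> models (State (rcons (vs i) i%:Z) (A i)) m ->
    exists m' N, [/\ uexec (While (Sub e (Var d)) body) m m' N,
      (N <= (k * (step_bound X body).+1).+1)%N &
      models (State (rcons (vs n) n%:Z) (A n)) m'].
  elim: k i m => [|k IH] i m hik hm.
    exists m, 1%N; split=> //; last by rewrite -{1 2 3}hik addn0.
    apply: uexec_while_false.
    by rewrite (evals_sub (he i _) (ev i i _) hm); lia.
  have hin : (i < n)%N by lia.
  have [m1 [N1 [r1 b1 hm1]]] := hbody i hin m hm.
  have [|m2 [N2 [r2 b2 hm2]]] := IH i.+1 m1 _ hm1; first by lia.
  exists m2, (N1 + N2).+1; split=> //; last by rewrite mulSn; lia.
  apply: uexec_while_true r1 r2.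
  by rewrite (evals_sub (he i _) (ev i i _) hm); lia.
have h0 : triple (State (vs 0%N) (A 0%N)) (SetVar d (Cst 0))
                 (State (rcons (vs 0%N) 0%:Z) (A 0%N)).
  by rewrite -(hd 0%N); apply: triple_newvar.
apply: triple_seq h0 _ => m hm.
have [//|m' [N [r b hm']]] := hloop n 0%N m _ hm.
exists m', N; split=> //; last exact: models_rcons hm'.
apply: leq_trans b _; rewrite /= ltnS; apply: leq_mul => //.
Qed.

(** The address is evaluated twice, the second time after the value has been written; hence [eu]
    must not depend on the array that is being changed. *)
Lemma triple_setentry vs q D O eu e (u : nat) z :
  (forall D, evals (State vs (focus q D O)) eu u) ->
  evals (State vs (focus q D O)) e z ->
  triple (State vs (focus q D O)) (SetEntry q eu e)
         (State vs (focus q (update D u z) O)).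
Proof.
move=> hu he m hm.
pose m1 := store m (cell (value_region q) u) z.
(* The value is written before the flag, so a previously absent entry is still absent here, while a
   present one has already changed. *)
have hm1 : models (State vs
    (focus q (if D u is Some _ then update D u z else D) O)) m1.
  rewrite /m1; case: hm => hi hv hf hd; split=> /=.
  - by move=> i; rewrite store_Posz.
  - by move=> j hj; rewrite store_cell ?value_region_lt5 //= -hv //; case: (q).
  - move=> q' i; rewrite store_cell ?value_region_lt5 ?flag_region_lt5 //.
    rewrite hf /= /focus; have [->|ne] := eqVneq q' q; last first.
      by case: (q') (q) ne => [] [].
    have -> : (flag_region q == value_region q) = false by case: (q).
    by case E: (D u) => //=; rewrite /update; case: eqP => // ->; rewrite E.
  - move=> q' i c; rewrite store_cell ?value_region_lt5 //.
    move=> h; have /= := hd q' i; rewrite /focus.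
    move: h; rewrite /focus; have [->|ne] := eqVneq q' q; last first.
      have -> : (value_region q' == value_region q) = false
        by case: (q') (q) ne => [] [].
      by move=> h; apply.
    rewrite eqxx /=; case E: (D u) => [c'|]; rewrite /update.
      by case: eqP => [_ [->]|_ h] //; apply.
    by case: eqP => [->|_]; [rewrite E | move=> h; apply].
pose m2 := store m1 (cell (flag_region q) u) 1.
exists m2, 2%N; split=> //.
  rewrite -[2%N]/(1 + 1)%N; apply: uexec_seq.
    rewrite -/m1.
    have := uexec_assign m (Cell (value_region q) eu) e.
    by rewrite (he m hm) (evals_cell _ (hu _) hm) -/m1; apply.
  have := uexec_assign m1 (Cell (flag_region q) eu) (Cst 1).
  by rewrite (evals_cell _ (hu _) hm1).
rewrite /m2; case: (hm1) => hi hv hf hd; split=> /=.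
- by move=> i; rewrite store_Posz.
- by move=> j hj; rewrite store_cell ?flag_region_lt5 //= -hv //; case: (q).
- move=> q' i; rewrite store_cell ?flag_region_lt5 //.
  rewrite hf /= /focus; have [->|ne] := eqVneq q' q; last first.
    by case: (q') (q) ne => [] [].
  by rewrite eqxx /= /update; case E: (D u) => [c|]; case: eqP.
- move=> q' i c; rewrite store_cell ?flag_region_lt5 ?value_region_lt5 //.
  have -> : (value_region q' == flag_region q) = false by case: (q') (q) => [] [].
  rewrite /= /focus; have [->|ne] := eqVneq q' q; last first.
    by move=> h; apply: hd; rewrite /= /focus (negbTE ne).
  rewrite /update; case: eqP => [->|ne] h.
    by case: h => <-; rewrite /m1 store_cell ?value_region_lt5 // !eqxx.
  apply: hd; rewrite /= /focus eqxx; case: (D u) => //= _.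
  by rewrite /update; case: eqP ne.
Qed.

(** * Commands that act as lists of relaxations *)

Section Relaxation.
Variables (q : bool) (O : entries).

(** As D is arbitrary, sequencing commands concatenates their lists and a loop flattens the lists of
    its iterations; verifying the program reduces to computing the list of arcs it relaxes. *)
Definition relaxes (vs : seq int) (c : cmd) (vs' : seq int)
    (L : seq (nat * nat * int)) : Prop :=
  forall D, triple (State vs (focus q D O)) c
                   (State vs' (focus q (foldl relax D L) O)).

Definition pevals (vs : seq int) (e : expr) (z : int) : Prop :=
  forall D, evals (State vs (focus q D O)) e z.

Lemma relaxes_relax vs eu ev ew (u v : nat) w :
  pevals vs eu u -> pevals vs ev v -> pevals vs ew w ->
  relaxes vs (Relax q eu ev ew) vs [:: (u, v, w)].
Proof.
move=> hu hv hw D /=.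
have fq D' : focus q D' O q = D' by rewrite /focus eqxx.
apply: triple_if; first exact: evals_flag (hu D).
  rewrite fq; case Eu: (D u) => [c|] // _.
  have hc : evals (State vs (focus q D O)) (Value q eu) c.
    by apply: evals_value (hu D) _; rewrite fq.
  apply: triple_if; first exact: evals_flag (hv D).
    rewrite fq; case Ev: (D v) => [c'|] // _.
    have hc' : evals (State vs (focus q D O)) (Value q ev) c'.
      by apply: evals_value (hv D) _; rewrite fq.
    apply: triple_if; first exact: evals_sub hc' (evals_add hc (hw D)).
      rewrite subr_gt0 => ->.
      by apply: triple_setentry => //; apply: evals_add hc (hw D).
    by rewrite subr_le0 leNgt => /negbTE ->; apply: triple_skip.
  rewrite fq; case Ev: (D v) => [c'|] // _.
  by apply: triple_setentry => //; apply: evals_add hc (hw D).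
by rewrite fq; case Eu: (D u) => [c|] // _; apply: triple_skip.
Qed.

Lemma relaxes_skip vs : relaxes vs Skip vs [::].
Proof. by move=> D; apply: triple_skip. Qed.

Lemma relaxes_seq vs1 vs2 vs3 c1 c2 L1 L2 :
  relaxes vs1 c1 vs2 L1 -> relaxes vs2 c2 vs3 L2 ->
  relaxes vs1 (Seq c1 c2) vs3 (L1 ++ L2).
Proof.
by move=> h1 h2 D; rewrite foldl_cat; apply: triple_seq (h1 D) (h2 _).
Qed.

Lemma relaxes_if vs vs' e z c1 c2 L :
  pevals vs e z -> (0 < z -> relaxes vs c1 vs' L) ->
  (z <= 0 -> relaxes vs c2 vs' L) -> relaxes vs (If e c1 c2) vs' L.
Proof.
by move=> he h1 h2 D; apply: triple_if (he D) _ _ => hz; [apply: h1|apply: h2].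
Qed.

Lemma relaxes_drop vs vs' z c L :
  relaxes vs c (rcons vs' z) L -> relaxes vs c vs' L.
Proof. by move=> h D; apply: triple_conseq (h D) => // m; apply: models_rcons. Qed.

Lemma relaxes_setvar vs j e z :
  (j <= size vs)%N -> pevals vs e z ->
  relaxes vs (SetVar j e) (set_nth 0 vs j z) [::].
Proof. by move=> hj he D; apply: triple_setvar. Qed.

Lemma relaxes_for (vs : nat -> seq int) d e c n (L : 'I_n -> seq _) :
  (n <= X)%N -> (forall i, size (vs i) = d) ->
  (forall i, pevals (rcons (vs i) i%:Z) e n) ->
  (forall i : 'I_n, relaxes (rcons (vs i) (i : nat)%:Z) c
                            (rcons (vs i.+1) (i : nat)%:Z) (L i)) ->
  relaxes (vs 0%N) (For d e c) (vs n) (flatten [seq L i | i <- enum 'I_n]).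
Proof.
move=> hX hd he hc D.
pose A i :=
  focus q (foldl relax D (flatten [seq L j | j <- take i (enum 'I_n)])) O.
have := @triple_for vs A d e c n hX hd.
rewrite /A take0 take_oversize ?size_enum_ord //; apply.
  by move=> i _; apply: he.
move=> i hi; have := hc (Ordinal hi)
  (foldl relax D (flatten [seq L j | j <- take i (enum 'I_n)])).
rewrite -foldl_cat -[L _]cats0 -[L _ ++ [::]]/(flatten [:: L (Ordinal hi)]).
rewrite -flatten_cat -[[:: L _]]/(map L [:: Ordinal hi]) -map_cat cats1.
rewrite (take_nth (Ordinal hi)) ?size_enum_ord //.
have -> : nth (Ordinal hi) (enum 'I_n) i = Ordinal hi; last by [].
by apply: val_inj; rewrite /= nth_enum_ord.
Qed.

Lemma relaxes_for_const vs d e c n (L : 'I_n -> seq _) :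
  (n <= X)%N -> size vs = d -> (forall i : nat, pevals (rcons vs i%:Z) e n) ->
  (forall i : 'I_n, relaxes (rcons vs (i : nat)%:Z) c
                            (rcons vs (i : nat)%:Z) (L i)) ->
  relaxes vs (For d e c) vs (flatten [seq L i | i <- enum 'I_n]).
Proof. by move=> hX hd; apply: (@relaxes_for (fun=> vs)). Qed.

End Relaxation.
End Triples.

(** * Walks and the Bellman-Ford algorithm *)

Section Walks.
Variables (V : finType) (e : rel V) (w : V -> V -> int).

Definition path_weight (x : V) (p : seq V) : int := \sum_(c <- pairmap w x p) c.

Lemma path_weight_nil x : path_weight x [::] = 0.
Proof. by rewrite /path_weight big_nil. Qed.

Lemma path_weight_cons x y p :
  path_weight x (y :: p) = w x y + path_weight y p.
Proof. by rewrite /path_weight big_cons. Qed.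

Lemma path_weight_cat x p q :
  path_weight x (p ++ q) = path_weight x p + path_weight (last x p) q.
Proof. by rewrite /path_weight pairmap_cat big_cat. Qed.

Lemma path_weight_rcons x p y :
  path_weight x (rcons p y) = path_weight x p + w (last x p) y.
Proof.
by rewrite -cats1 path_weight_cat path_weight_cons path_weight_nil addr0.
Qed.

Hypothesis cycle_ge0 :
  forall x p, ucycle e (x :: p) -> 0 <= path_weight x (rcons p x).

Lemma walk_shorten x p : path e x p ->
  exists q, [/\ path e x q, last x q = last x p, uniq (x :: q),
    path_weight x q <= path_weight x p & {subset x :: q <= x :: p}].
Proof.
elim: p x => [|y p IH] x /=; first by exists [::]; split.
case/andP=> exy /IH[q [pq lq uq wq sq]].
have sub z : z \in y :: q -> z \in x :: y :: p.
  by move=> /sq h; rewrite inE h orbT.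
have [xq|xq] := boolP (x \in y :: q); last first.
  exists (y :: q); split=> //.
  - by rewrite /= exy pq.
  - by rewrite cons_uniq xq; apply: uq.
  - by rewrite !path_weight_cons lerD2l.
  - by move=> z; rewrite inE => /predU1P[->|/sub //]; rewrite mem_head.
have pyq : path e x (y :: q) by rewrite /= exy pq.
have wyq : path_weight x (y :: q) <= path_weight x (y :: p).
  by rewrite !path_weight_cons lerD2l.
rewrite -[last y q]/(last x (y :: q)) in lq.
move: (y :: q) xq pyq wyq lq sub uq => r xr.
case/splitPr: xr => q1 q2 pr wr lr sub ur.
exists q2; split.
- by move: pr; rewrite cat_path /= => /and3P[].
- by rewrite -lr last_cat.
- by move: ur; rewrite cat_uniq => /and3P[].
- apply: le_trans wr.
  rewrite -cat1s catA path_weight_cat cats1 last_rcons lerDr.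
  apply: cycle_ge0; apply/andP; split.
    by rewrite /=; move: pr; rewrite -cat1s catA cat_path cats1 => /andP[].
  move: ur; rewrite cat_uniq => /and3P[uq1 nq /= /andP[xq2 _]].
  rewrite uq1 andbT; apply: contra nq => xq1.
  by apply/hasP; exists x; rewrite // mem_head.
- move=> z; rewrite inE => /predU1P[->|zq]; first by rewrite mem_head.
  by apply: sub; rewrite mem_cat inE zq !orbT.
Qed.

End Walks.

(** * Relaxation of arcs *)

Definition below (D : entries) (v : nat) (c : int) : Prop :=
  exists2 c', D v = Some c' & c' <= c.

Lemma relax_below D t v c : below D v c -> below (relax D t) v c.
Proof.
case: t => [[u x] w] [c' h le]; rewrite /relax.
case: (D u) => [cu|]; last by exists c'.
case Ex: (D x) => [cx|]; last first.
  exists c' => //; rewrite /update; case: eqP => // vx.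
  by rewrite -vx h in Ex.
case: ltP => hx; last by exists c'.
have [vx|ne] := eqVneq v x; last first.
  by exists c'; rewrite // /update (negbTE ne).
exists (cu + w); first by rewrite /update vx eqxx.
by apply: le_trans le; move: h; rewrite vx Ex => -[<-]; apply: ltW.
Qed.

Lemma relax_edge D u v w c :
  below D u c -> below (relax D (u, v, w)) v (c + w).
Proof.
case=> c' h le; rewrite /relax h.
have upd : below (update D v (c' + w)) v (c + w).
  by exists (c' + w); rewrite ?lerD2r // /update eqxx.
case Ev: (D v) => [cv|] //; case: ltP => // hv.
by exists cv; rewrite // (le_trans hv) ?lerD2r.
Qed.

Lemma foldl_relax_below D L v c : below D v c -> below (foldl relax D L) v c.
Proof. by elim: L D => //= t L IH D /(relax_below t)/IH. Qed.

Lemma foldl_relax_edge D L u v w c :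
  (u, v, w) \in L -> below D u c -> below (foldl relax D L) v (c + w).
Proof.
elim: L D => //= t L IH D; rewrite inE => /predU1P[<-|tL] h.
  by apply: foldl_relax_below; apply: relax_edge.
by apply: IH tL _; apply: relax_below.
Qed.

(** Soundness of relaxation: with P v c saying that some walk to v has weight c, entries never leave
    P. *)
Lemma foldl_relax_inv (P : nat -> int -> Prop) D L :
  (forall u v w c, (u, v, w) \in L -> P u c -> P v (c + w)) ->
  (forall v c, D v = Some c -> P v c) ->
  forall v c, foldl relax D L v = Some c -> P v c.
Proof.
elim: L D => //= -[[u v] w] L IH D hL hD.
apply: IH => [u' v' w' c h|x c]; first by apply: hL; rewrite inE h orbT.
rewrite /relax; case Eu: (D u) => [cu|]; last exact: hD.
have hv : P v (cu + w) by apply: hL (hD _ _ Eu); rewrite mem_head.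
have upd : update D v (cu + w) x = Some c -> P x c.
  by rewrite /update; case: eqP => [-> [<-]|_] //; apply: hD.
by case: (D v) => [cv|] //; case: ifP => _ //; apply: hD.
Qed.

Definition rounds (L : seq (nat * nat * int)) (r : nat) (src : nat) : entries :=
  iter r (fun D => foldl relax D L) (update (fun=> None) src 0).

(** * Correctness of Bellman-Ford, and tight edges *)

Section BellmanFord.
Variables (V : finType) (code : V -> nat) (e : rel V) (w : V -> V -> int).
Variables (L : seq (nat * nat * int)) (s : V) (r : nat).
Hypothesis code_inj : injective code.
Hypothesis L_edges : forall t, reflect
  (exists x y, e x y /\ t = (code x, code y, w x y)) (t \in L).
Hypothesis cycle_ge0 :
  forall x p, ucycle e (x :: p) -> 0 <= path_weight w x (rcons p x).
Hypothesis enough : (#|V| <= r)%N.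

Let D := rounds L r (code s).

Lemma rounds_walk y c : D (code y) = Some c ->
  exists p, [/\ path e s p, last s p = y & path_weight w s p = c].
Proof.
pose P u a := exists p,
  [/\ path e s p, u = code (last s p) & path_weight w s p = a].
have : forall u a, D u = Some a -> P u a.
  rewrite /D /rounds; elim: r => [|i IH] /=.
    move=> u a; rewrite /update; case: eqP => // -> [<-].
    by exists [::]; rewrite path_weight_nil.
  apply: foldl_relax_inv => // u v c' a /L_edges[x [z [exz [-> -> ->]]]].
  case=> p [pp /code_inj xE wp]; exists (rcons p z).
  by rewrite rcons_path pp -xE exz last_rcons path_weight_rcons wp xE.
by move=> h /h[p [pp /code_inj -> wp]]; exists p.
Qed.

(** Round i accounts for all walks of at most i edges, and a shortened walk has fewer edges than
    there are vertices. *)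
Lemma rounds_below p : path e s p ->
  below D (code (last s p)) (path_weight w s p).
Proof.
case/(walk_shorten cycle_ge0)=> q [pq <- uq wq _].
suff [c hc le] : below D (code (last s q)) (path_weight w s q).
  by exists c => //; apply: le_trans wq.
have : (size q <= r)%N.
  apply: leq_trans enough; apply: ltnW.
  by have := max_card (mem (s :: q)); rewrite (card_uniqP uq).
rewrite /D /rounds {uq wq p}; elim: r q pq => [|i IH] q.
  case: q => // _ _; exists 0; last by rewrite path_weight_nil.
  by rewrite /= /update eqxx.
case/lastP: q => [|q y].
  move=> _ _; have [|c hc le] := IH [::] isT => //.
  by apply: foldl_relax_below; exists c.
rewrite rcons_path size_rcons last_rcons path_weight_rcons => /andP[pq ey] sz.
rewrite iterS; apply: foldl_relax_edge (IH q pq sz).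
by apply/L_edges; exists (last s q), y.
Qed.

Lemma rounds_step x y c : D (code x) = Some c -> e x y ->
  below D (code y) (c + w x y).
Proof.
case/rounds_walk=> p [pp <- <-] ey.
by have := @rounds_below (rcons p y); rewrite rcons_path last_rcons
  path_weight_rcons pp ey; apply.
Qed.

(** The empty walk gives at most 0. The entry is also the weight of a closed walk at s, which
    shortens to the empty path and so weighs at least 0. *)
Lemma rounds_source : D (code s) = Some 0.
Proof.
have [c hc le] := @rounds_below [::] isT; rewrite path_weight_nil /= in hc le.
rewrite hc; congr Some; apply/eqP; rewrite eq_le le /=.
have [p [pp lp <-]] := rounds_walk hc.
have [[|y q] [_ lq uq wq _]] := walk_shorten cycle_ge0 pp.
  by rewrite path_weight_nil in wq.
by move: uq; rewrite -[s]lp -lq /= mem_last.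
Qed.

Lemma rounds_along x p c : D (code x) = Some c -> path e x p ->
  below D (code (last x p)) (c + path_weight w x p).
Proof.
case/rounds_walk=> q [pq lq <-] pp.
have := @rounds_below (q ++ p).
by rewrite cat_path last_cat path_weight_cat lq pq pp; apply.
Qed.

(** By [rounds_step] the reverse inequality always holds, so this is equality of dist(x) + w(x, y)
    and dist(y), both finite. *)
Definition tight_edge (x y : V) : bool :=
  e x y && (if D (code x) is Some c then
              if D (code y) is Some c' then c + w x y <= c' else false
            else false).

Lemma tight_edge_sub : subrel tight_edge e.
Proof. by move=> x y /andP[]. Qed.

Lemma tight_walk_weight p : path tight_edge s p ->
  D (code (last s p)) = Some (path_weight w s p).
Proof.
elim/last_ind: p => [|p y IH]; first by rewrite path_weight_nil rounds_source.
rewrite rcons_path last_rcons path_weight_rcons => /andP[/IH h].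
rewrite /tight_edge h => /andP[ey].
have [c -> le] := rounds_step h ey => le'.
by congr Some; apply/eqP; rewrite eq_le le le'.
Qed.

(** Slack at an edge would make the distance of the last vertex smaller than the weight along p,
    since the rest of p can be walked from there. *)
Lemma tight_of_shortest x p c :
  D (code x) = Some c -> path e x p ->
  D (code (last x p)) = Some (c + path_weight w x p) ->
  path tight_edge x p.
Proof.
elim: p x c => //= y p IH x c hx /andP[exy pp].
have [cy hy le] := rounds_step hx exy.
have [cl hl le'] := rounds_along hy pp.
rewrite hl path_weight_cons => -[E].
have Ecy : cy = c + w x y by lia.
rewrite /tight_edge exy hx hy Ecy lexx /=; apply: IH pp _; first exact: hy.
by rewrite hl E Ecy addrA.
Qed.

End BellmanFord.

(** * The graph of states *)

Section Bits.
Local Open Scope nat_scope.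

Definition bit (X i : nat) : bool := odd (X %/ 2 ^ i).

Lemma bit0 i : bit 0 i = false.
Proof. by rewrite /bit div0n. Qed.

(** This form allows the machine, which has neither division nor bit tests, to enumerate the masks
    without bit i. *)
Lemma bit_clearP X i :
  reflect (exists hi lo, lo < 2 ^ i /\ X = hi * 2 ^ i.+1 + lo) (~~ bit X i).
Proof.
have p0 : 0 < 2 ^ i by rewrite expn_gt0.
apply: (iffP idP) => [ev|[hi [lo [h ->]]]].
  exists (X %/ 2 ^ i)./2, (X %% 2 ^ i); split; first by rewrite ltn_pmod.
  rewrite {1}(divn_eq X (2 ^ i)) -{1}[X %/ 2 ^ i]odd_double_half.
  by rewrite -/(bit X i) (negbTE ev) add0n expnS -mul2n; congr (_ + _); lia.
rewrite /bit expnS mulnA divnMDl // (divn_small h) addn0.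
by rewrite oddM andbF.
Qed.

Lemma bit_set X i j : ~~ bit X i -> bit (X + 2 ^ i) j = (j == i) || bit X j.
Proof.
case/bit_clearP=> hi [lo [h ->]]; rewrite /bit.
have p0 m : 0 < 2 ^ m by rewrite expn_gt0.
case: (ltngtP j i) => [ji|ij|->] /=.
- have -> : 2 ^ i = (2 ^ (i - j.+1)).*2 * 2 ^ j.
    by rewrite -mul2n -expnS -expnD; congr (2 ^ _); lia.
  by rewrite [_ + _ * 2 ^ j]addnC divnMDl // oddD odd_double.
- have small m : m < 2 ^ i.+1 -> (hi * 2 ^ i.+1 + m) %/ 2 ^ j = hi %/ 2 ^ (j - i.+1).
    move=> hm; rewrite -{1}(subnKC ij) expnD divnMA divnMDl //.
    by rewrite (divn_small hm) addn0.
  by rewrite -addnA !small // expnS; lia.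
- rewrite -addnA expnS mulnA divnMDl // -[lo + _]addnC -{1}[2 ^ i]mul1n.
  by rewrite divnMDl // (divn_small h) addn0 oddD oddM andbF.
Qed.

Lemma set_bit_lt X i k : X < 2 ^ k -> i < k -> ~~ bit X i -> X + 2 ^ i < 2 ^ k.
Proof.
move=> hX ik /bit_clearP[hi [lo [h eX]]].
have e : 2 ^ k = 2 ^ (k - i.+1) * 2 ^ i.+1 by rewrite -expnD subnK.
have p0 : 0 < 2 ^ i by rewrite expn_gt0.
have : hi < 2 ^ (k - i.+1).
  by rewrite -(ltn_pmul2r (m := 2 ^ i.+1)) ?expn_gt0 // -e; lia.
rewrite e eX expnS; nia.
Qed.

End Bits.

(** * Labelled tokens *)

Section Tokens.
Variables (n k : nat) (M : wdigraph n).
Implicit Types f g : 'I_k -> 'I_n.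

Definition config f : {mset 'I_n}%mset := seq_mset [seq f i | i <- enum 'I_k].

Definition move_token f i y : 'I_k -> 'I_n := fun j => if j == i then y else f j.

Lemma configE f z : config f z = (\sum_(i < k) (f i == z))%N.
Proof.
by rewrite mset_seqE -sum1_count big_map big_enum_cond big_mkcond.
Qed.

Lemma in_config f z : reflect (exists i, f i = z) (z \in config f).
Proof.
rewrite -mset_gt0 configE lt0n sum_nat_eq0.
apply: (iffP idP) => [|[i <-]].
  by rewrite negb_forall => /existsP[i]; rewrite /= eqb0 negbK => /eqP; exists i.
by apply/negP => /forallP/(_ i); rewrite /= eqxx.
Qed.

Lemma config_move f i y :
  config (move_token f i y) = (y +` (config f `\ f i))%mset.
Proof.
apply/msetP => z; rewrite mset1DE msetB1E !configE.
rewrite (bigD1 i) //= [in RHS](bigD1 i) //= /move_token eqxx.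
rewrite [y == z]eq_sym [z == f i]eq_sym addKn; congr (_ + _)%N.
by apply: eq_bigr => j /negbTE ->.
Qed.

Lemma moves_rcons S T x y c :
  moves M S T c -> x \in T -> edge M x y ->
  moves M S (y +` (T `\ x))%mset (c + weight M x y).
Proof.
elim=> [U xU xy|U T' x' y' c' x'U xy' _ IH xT xy].
  by rewrite add0r -[weight M x y]addr0; apply: moves_cons (moves_nil _ _).
by rewrite -addrA; apply: moves_cons => //; apply: IH.
Qed.

(** Labels tell which token makes each move, so the moves regroup into one walk per token and the
    total cost into a sum over tokens. *)
Lemma moves_tokens f S T c : moves M S T c -> S = config f ->
  exists g (cs : 'I_k -> int),
  [/\ T = config g,
      forall i, exists p, [/\ path (edge M) (f i) p, last (f i) p = g i
                            & path_weight (weight M) (f i) p = cs i]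
    & \sum_i cs i = c].
Proof.
move=> mv; elim: mv f => [U f ->|U T' x y c' xU xy _ IH f eU].
  exists f, (fun=> 0); split=> //; last by rewrite big1.
  by move=> i; exists [::]; rewrite path_weight_nil.
move: xU; rewrite eU => /in_config[i fi].
have [|g [cs [eT hp hs]]] := IH (move_token f i y).
  by rewrite config_move eU fi.
exists g, (fun j => if j == i then weight M x y + cs j else cs j); split=> //.
  move=> j; have := hp j; rewrite /move_token.
  case: eqP => [->|_] // [p [pp lp wp]].
  by exists (y :: p); rewrite /= path_weight_cons fi xy pp lp wp.
rewrite -hs (bigD1 i) //= eqxx [in RHS](bigD1 i) //= addrA; congr (_ + _).
by apply: eq_bigr => j /negbTE ->.
Qed.

End Tokens.

Section StateGraph.
Variables (n k : nat) (M : wdigraph n) (tight : rel 'I_n) (tok : 'I_k -> 'I_n).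
Variable s : 'I_n.
Hypothesis weight_ge0 : forall x y, edge M x y -> 0 <= weight M x y.

(* In the state (X, v, a), X is the set of the tokens already used, v is the  *)
(* last vertex of the walk under construction, and a is the current position  *)
(* of the token on its way to v, or None if no token was chosen for v yet.    *)
Definition vertex := ('I_(2 ^ k) * 'I_n * option 'I_n)%type.

Definition vedge (x y : vertex) : bool :=
  let: (X, v, a) := x in let: (Y, u, b) := y in
  match a, b with
  | None, Some z =>
      (v == u) && [exists i : 'I_k, [&& tok i == z, ~~ bit X i
                                      & (Y == X + 2 ^ i :> nat)%N]]
  | Some x, Some y => [&& X == Y, v == u & edge M x y]
  | Some x, None => [&& X == Y, x == v & tight v u]
  | None, None => false
  end.

Definition vweight (x y : vertex) : int :=
  if (x.2, y.2) is (Some x, Some y) then weight M x y else 0.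

Lemma mask0_subproof : (0 < 2 ^ k)%N. Proof. by rewrite expn_gt0. Qed.
Definition start : vertex := (Ordinal mask0_subproof, s, None).

Lemma vweight_ge0 x y : vedge x y -> 0 <= vweight x y.
Proof.
case: x y => [[X v] [a|]] [[Y u] [b|]] //= /and3P[_ _].
exact: weight_ge0.
Qed.

Lemma vpath_weight_ge0 x p : path vedge x p -> 0 <= path_weight vweight x p.
Proof.
elim: p x => [|y p IH] x /=; first by rewrite path_weight_nil.
by case/andP=> /vweight_ge0 h /IH; rewrite path_weight_cons; apply: addr_ge0.
Qed.

Lemma vertex_walk_sound p X v a : path vedge start p -> last start p = (X, v, a) ->
  exists q (f : 'I_k -> 'I_n),
  [/\ path tight s q, last s q = v,
      moves M (config tok) (config f) (path_weight vweight start p),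
      forall i : 'I_k, ~~ bit X i -> f i = tok i &
      if a is Some x then
        exists i : 'I_k, [/\ bit X i, f i = x &
          forall u, u \in belast s q -> exists2 j : 'I_k, j != i & bit X j && (f j == u)]
      else forall u, u \in belast s q -> exists j : 'I_k, bit X j && (f j == u)].
Proof.
elim/last_ind: p X v a => [|p [[X' v'] a'] IH] X v a.
  move=> _ [<- <- <-]; exists [::], tok; rewrite path_weight_nil; split=> //.
  exact: moves_nil.
rewrite rcons_path last_rcons path_weight_rcons => /andP[pp].
case E: (last start p) => [[Y u] b] ed [? ? ?]; subst X' v' a'.
have {IH pp E} [q [f [pq lq mv ht]]] := IH _ _ _ pp E.
rewrite /vweight /=; case: b a ed => [x|] [y|] //=.
- case/and3P=> /eqP eX /eqP ev xy [i [bi fi hi]]; subst X v.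
  exists q, (move_token f i y); split=> //.
  + rewrite config_move; rewrite -fi; apply: moves_rcons => //; last by rewrite fi.
    by apply/in_config; exists i.
  + move=> j bj; rewrite /move_token; case: eqP => [ji|_]; last exact: ht.
    by move: bj; rewrite ji bi.
  + exists i; split=> //; first by rewrite /move_token eqxx.
    by move=> z /hi[j ji h]; exists j => //; rewrite /move_token (negbTE ji).
- case/and3P=> /eqP eX /eqP xv uv [i [bi fi hi]]; subst X.
  exists (rcons q v), f; split=> //.
  + by rewrite rcons_path pq lq.
  + by rewrite last_rcons.
  + by rewrite addr0.
  + move=> z; rewrite belast_rcons lastI mem_rcons inE => /predU1P[->|].
      by exists i; rewrite bi fi lq xv eqxx.
    by case/hi=> j _ h; exists j.
- case/andP=> /eqP ev /existsP[i /and3P[/eqP ey bi /eqP eX]] hi; subst v y.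
  exists q, f; split=> //.
  + by rewrite addr0.
  + by move=> j; rewrite eX bit_set // negb_or => /andP[_]; apply: ht.
  + exists i; split=> //; [by rewrite eX bit_set ?eqxx | exact: ht|].
    move=> z /hi[j /andP[bj fj]]; exists j; last by rewrite eX bit_set // bj orbT.
    by apply: contra bi => /eqP <-.
Qed.

Lemma vertex_token_walk X v x p : path (edge M) x p ->
  exists q, [/\ path vedge (X, v, Some x) q,
    last (X, v, Some x) q = (X, v, Some (last x p))
  & path_weight vweight (X, v, Some x) q = path_weight (weight M) x p].
Proof.
elim: p x => [|y p IH] x /=; first by exists [::]; rewrite !path_weight_nil.
case/andP=> xy /IH[q [pq lq wq]].
by exists ((X, v, Some y) :: q); rewrite /= !eqxx xy pq lq !path_weight_cons wq.
Qed.

Section Complete.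
Variables (g : 'I_k -> 'I_n) (cs : 'I_k -> int).
Hypothesis token_walk : forall i, exists p,
  [/\ path (edge M) (tok i) p, last (tok i) p = g i
    & path_weight (weight M) (tok i) p = cs i].

Lemma vertex_walk_cover (X : 'I_(2 ^ k)) v (i : 'I_k) : ~~ bit X i -> g i = v ->
  exists (Y : 'I_(2 ^ k)) q, [/\ Y = (X + 2 ^ i)%N :> nat,
    path vedge (X, v, None) q, last (X, v, None) q = (Y, v, Some v)
  & path_weight vweight (X, v, None) q = cs i].
Proof.
move=> bi gi; pose Y := Ordinal (set_bit_lt (ltn_ord X) (ltn_ord i) bi).
have [p [pp lp wp]] := token_walk i.
have [q [pq lq wq]] := vertex_token_walk Y v pp.
exists Y, ((Y, v, Some (tok i)) :: q); split=> //=.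
- rewrite pq eqxx andbT; apply/existsP; exists i.
  by rewrite !eqxx bi.
- by rewrite lq lp gi.
- by rewrite path_weight_cons wq wp add0r.
Qed.

Lemma vertex_walk_complete p : path tight s p -> uniq (s :: p) ->
  (forall u, u \in s :: p -> exists i, g i = u) ->
  exists (X : 'I_(2 ^ k)) q, [/\ path vedge start q,
    last start q = (X, last s p, Some (last s p)),
    path_weight vweight start q = \sum_(i < k | bit X i) cs i
  & forall i : 'I_k, bit X i -> g i \in s :: p].
Proof.
(* Covering v by a fresh token when all used tokens end in r; this serves both for the first vertex
   and for each later one. *)
have step (X : 'I_(2 ^ k)) q v (r : seq 'I_n) : path vedge start q ->
    last start q = (X, v, None) ->
    path_weight vweight start q = \sum_(i < k | bit X i) cs i ->
    (forall i : 'I_k, bit X i -> g i \in r) -> v \notin r -> (exists i, g i = v) ->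
    exists (Y : 'I_(2 ^ k)) q', [/\ path vedge start q',
      last start q' = (Y, v, Some v),
      path_weight vweight start q' = \sum_(i < k | bit Y i) cs i
    & forall i : 'I_k, bit Y i -> g i \in rcons r v].
  move=> pq lq wq hr vr [i gi].
  have bi : ~~ bit X i by apply: contra vr => /hr; rewrite gi.
  have [Y [q' [eY pq' lq' wq']]] := vertex_walk_cover bi gi.
  exists Y, (q ++ q'); split.
  - by rewrite cat_path pq lq.
  - by rewrite last_cat lq.
  - rewrite path_weight_cat lq wq wq' [RHS](bigD1 i) /=; last first.
      by rewrite eY bit_set ?eqxx.
    rewrite addrC; congr (_ + _); apply: eq_bigl => j; rewrite eY bit_set //.
    rewrite -val_eqE /=; have [->|_] := eqVneq (j : nat) i.
      by rewrite (negbTE bi) andbF.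
    by rewrite andbT.
  - move=> j; rewrite eY bit_set // mem_rcons inE => /orP[/eqP/val_inj ->|/hr ->].
      by rewrite gi eqxx.
    by rewrite orbT.
elim/last_ind: p => [|p v IH] pp up cov.
  apply: (step (Ordinal mask0_subproof) [::] s [::]) => //=.
  - by rewrite path_weight_nil big1 // => i; rewrite bit0.
  - by move=> i; rewrite bit0.
  - by apply: cov; rewrite mem_head.
move: pp up; rewrite rcons_path -rcons_cons rcons_uniq => /andP[pp lv] /andP[vp up].
have [|X [q [pq lq wq hq]]] := IH pp up.
  by move=> u up'; apply: cov; rewrite -rcons_cons mem_rcons inE up' orbT.
rewrite last_rcons; apply: (step X (rcons q (X, v, None)) v (s :: p)) => //.
- by rewrite rcons_path pq lq /= !eqxx.
- by rewrite last_rcons.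
- by rewrite path_weight_rcons lq /vweight /= addr0.
- by apply: cov; rewrite -rcons_cons mem_rcons mem_head.
Qed.

End Complete.
End StateGraph.

(** * The answer computed from the distances *)

Lemma mem_flatten_enum (T : eqType) m (f : 'I_m -> seq T) t :
  reflect (exists i, t \in f i) (t \in flatten [seq f i | i <- enum 'I_m]).
Proof.
apply: (iffP flatten_mapP) => [[i _]|[i]]; first by exists i.
by exists i; rewrite ?mem_enum.
Qed.

(** Mixed radix with digits v < n and a <= n; the digit a = n stands for no chosen token. *)
Definition state_code (n X v a : nat) : nat := ((X * n + v) * n.+1 + a)%N.

Lemma state_code_inj n X v a X' v' a' :
  (v < n)%N -> (a < n.+1)%N -> (v' < n)%N -> (a' < n.+1)%N ->
  state_code n X v a = state_code n X' v' a' -> [/\ X = X', v = v' & a = a'].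
Proof.
move=> hv ha hv' ha' /(congr1 (edivn^~ n.+1)).
rewrite /state_code !edivn_eq // => -[/(congr1 (edivn^~ n))].
by rewrite !edivn_eq // => -[-> ->] ->.
Qed.

(** With zero weights every path is shortest and no cycle is negative, so [false] turns Shortest
    Path Discovery into Path Discovery. *)
Definition reweight (b : bool) n (G : wdigraph n) : wdigraph n :=
  if b then G else WDigraph (edge G) (fun _ _ => 0).

Lemma edge_reweight b n (G : wdigraph n) : edge (reweight b G) = edge G.
Proof. by case: b. Qed.

Lemma walk_weight_unweighted n (G : wdigraph n) x p :
  walk_weight (reweight false G) x p = 0.
Proof.
elim: p x => [|y p IH] x; first by rewrite /walk_weight big_nil.
by rewrite /walk_weight big_cons add0r; apply: IH.
Qed.

Section Answer.
Variables (b : bool) (I : instance).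
Let n := nvertices I.
Let k := ntokens I.
Let M := Mgraph I.
Let s := source I.
Let t := target I.
Let G := reweight b (Ggraph I).

Definition token_pos (i : 'I_k) : 'I_n := tnth (in_tuple (tokens I)) i.

Lemma config_token_pos : config token_pos = tokens I.
Proof.
rewrite -[RHS]seq_mset_id /config; congr seq_mset.
by rewrite -[RHS]/(val (in_tuple (tokens I))) -[RHS]map_tnth_enum.
Qed.

Definition graph_edges : seq (nat * nat * int) :=
  flatten [seq flatten
    [seq if edge G u v then [:: (u : nat, v : nat, weight G u v)] else [::]
    | v <- enum 'I_n] | u <- enum 'I_n].

Definition graph_dist : entries := rounds graph_edges n s.

Definition tight : rel 'I_n :=
  tight_edge (@nat_of_ord n) (edge G) (weight G) graph_edges s n.

(** Listed in the order in which the loops of [move_cmd] meet the arcs, so that the rules for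
    [relaxes] produce exactly this list. *)
Definition move_edges : seq (nat * nat * int) :=
  flatten [seq flatten [seq
    flatten [seq flatten [seq
      if edge M x y then
        [:: (state_code n X v x, state_code n X v y, weight M x y)] else [::]
      | y : 'I_n <- enum 'I_n] | x : 'I_n <- enum 'I_n] ++
    flatten [seq
      if tight v u then [:: (state_code n X v v, state_code n X u n, 0)] else [::]
      | u : 'I_n <- enum 'I_n]
    | v : 'I_n <- enum 'I_n] | X : 'I_(2 ^ k) <- enum 'I_(2 ^ k)].

(** Here hi runs through a range that is larger than necessary, and the test discards masks outside
    'I_(2 ^ k). *)
Definition pick_edges : seq (nat * nat * int) :=
  flatten [seq flatten [seq flatten [seq
    if (hi * 2 ^ i.+1 + lo + 2 ^ i < 2 ^ k)%N then
      flatten [seq [::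
        (state_code n (hi * 2 ^ i.+1 + lo) v n,
         state_code n (hi * 2 ^ i.+1 + lo + 2 ^ i) v (token_pos i), 0)]
      | v : 'I_n <- enum 'I_n]
    else [::]
    | lo : 'I_(2 ^ i) <- enum 'I_(2 ^ i)] | hi : 'I_(2 ^ k) <- enum 'I_(2 ^ k)]
    | i : 'I_k <- enum 'I_k].

Definition state_edges := move_edges ++ pick_edges.

Definition state_dist : entries :=
  rounds state_edges (2 ^ k * n * n.+1)%N (state_code n 0 s n).

Definition success (X : nat) : bool :=
  if state_dist (state_code n X t t) is Some c then c <= budget I else false.

Definition answer : bool := [exists X : 'I_(2 ^ k), success X].

Definition vertex_code (x : vertex n k) : nat :=
  state_code n x.1.1 x.1.2 (if x.2 is Some y then y : nat else n).

Lemma vertex_code_inj : injective vertex_code.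
Proof.
move=> [[X v] a] [[Y u] c] /state_code_inj /=.
case; try by [case: a => //= a; apply: ltnW; exact: ltn_ord
             |case: c => //= c; apply: ltnW; exact: ltn_ord].
move=> /val_inj-> /val_inj->.
case: a c => [a|] [c|] //=; first by move/val_inj ->.
  by move=> e; have := ltn_ord a; rewrite e ltnn.
by move=> e; have := ltn_ord c; rewrite -e ltnn.
Qed.

Lemma graph_edgesP (e : nat * nat * int) : reflect
  (exists x y : 'I_n, edge G x y /\ e = (x : nat, y : nat, weight G x y))
  (e \in graph_edges).
Proof.
apply: (iffP (mem_flatten_enum _ _)) => [[x /mem_flatten_enum[y]]|[x [y [xy ->]]]].
  by case: ifP => // xy; rewrite inE => /eqP ->; exists x, y.
by exists x; apply/mem_flatten_enum; exists y; rewrite xy mem_head.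
Qed.

Lemma state_edgesP (e : nat * nat * int) : reflect
  (exists x y, vedge M tight token_pos x y /\
     e = (vertex_code x, vertex_code y, vweight M x y))
  (e \in state_edges).
Proof.
apply: (iffP idP) => [|[[[X v] a] [[[Y u] c]]]].
  rewrite mem_cat => /orP[].
    case/mem_flatten_enum=> X /mem_flatten_enum[v]; rewrite mem_cat => /orP[].
      case/mem_flatten_enum=> x /mem_flatten_enum[y]; case: ifP => // xy.
      rewrite inE => /eqP ->; exists (X, v, Some x), (X, v, Some y).
      by rewrite /= !eqxx.
    case/mem_flatten_enum=> u; case: ifP => // vu.
    rewrite inE => /eqP ->; exists (X, v, Some v), (X, u, None).
    by rewrite /= !eqxx.
  case/mem_flatten_enum=> i /mem_flatten_enum[hi /mem_flatten_enum[lo]].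
  case: ifP => // lt /mem_flatten_enum[v]; rewrite inE => /eqP ->.
  have lt' : (hi * 2 ^ i.+1 + lo < 2 ^ k)%N by apply: leq_ltn_trans lt; apply: leq_addr.
  exists (Ordinal lt', v, None), (Ordinal lt, v, Some (token_pos i)).
  split=> //=; rewrite eqxx; apply/existsP; exists i; rewrite !eqxx andbT /=.
  by apply/bit_clearP; exists hi, lo.
rewrite /state_edges mem_cat => -[h ->]; apply/orP; move: h.
case: a c => [x|] [y|] //=.
- case/and3P=> /eqP <- /eqP <- xy; left.
  apply/mem_flatten_enum; exists X; apply/mem_flatten_enum; exists v.
  rewrite mem_cat; apply/orP; left.
  apply/mem_flatten_enum; exists x; apply/mem_flatten_enum; exists y.
  by rewrite xy mem_head.
- case/and3P=> /eqP <- /eqP -> vu; left.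
  apply/mem_flatten_enum; exists X; apply/mem_flatten_enum; exists v.
  rewrite mem_cat; apply/orP; right.
  by apply/mem_flatten_enum; exists u; rewrite vu mem_head.
- case/andP=> /eqP <- /existsP[i /and3P[/eqP <- bi /eqP eY]]; right.
  have [hi [lo [ltlo eX]]] := bit_clearP _ _ bi.
  have lthi : (hi < 2 ^ k)%N.
    have := ltn_ord X; rewrite eX; have : (0 < 2 ^ i.+1)%N by rewrite expn_gt0.
    by nia.
  apply/mem_flatten_enum; exists i; apply/mem_flatten_enum; exists (Ordinal lthi).
  apply/mem_flatten_enum; exists (Ordinal ltlo) => /=.
  rewrite -eX -eY ltn_ord; apply/mem_flatten_enum; exists v.
  by rewrite mem_head.
Qed.

Lemma graph_cycle_ge0 x p : ucycle (edge G) (x :: p) ->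
  0 <= path_weight (weight G) x (rcons p x).
Proof.
rewrite /G edge_reweight -[path_weight _ _ _]/(walk_weight G x _).
move=> /Ggraph_no_negative_cycle; rewrite /G; case: (b) => //.
by rewrite walk_weight_unweighted.
Qed.

Lemma state_cycle_ge0 x p : ucycle (vedge M tight token_pos) (x :: p) ->
  0 <= path_weight (vweight M) x (rcons p x).
Proof.
case/andP=> /vpath_weight_ge0 h _; apply: h.
exact: Mgraph_weight_ge0.
Qed.

Lemma enough_graph_rounds : (#|'I_n| <= n)%N.
Proof. by rewrite card_ord. Qed.

Lemma enough_state_rounds : (#|{: vertex n k}| <= 2 ^ k * n * n.+1)%N.
Proof. by rewrite !card_prod card_option !card_ord. Qed.

(** Both directions compare distances in the state graph with costs of moves, and distances in G
    with weights of paths. *)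
Lemma answerP : reflect
  (exists T p, [/\ reachable M (tokens I) (budget I) T,
     is_shortest_path G s t p & {subset s :: p <= T}])
  answer.
Proof.
have tight_sub x p : path tight x p -> path (edge G) x p.
  by apply: sub_path; apply: tight_edge_sub.
have gd_below := rounds_below (s := s) graph_edgesP graph_cycle_ge0 enough_graph_rounds.
apply: (iffP existsP) => [[X]|[T [p [[c mv cb] [[pp lp up] mp] sT]]]].
  rewrite /success; case E: (state_dist _) => [c|] // cb.
  have [p [pp lp wp]] := @rounds_walk _ vertex_code _ _ _ (start k s) _
    vertex_code_inj state_edgesP (X, t, Some t) c E.
  have [q [f [pq lq mv _ [i [bi fi cov]]]]] := vertex_walk_sound pp lp.
  (* The tight walk q may repeat vertices; its shortening r visits only vertices of q, hence remains
     covered. *)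
  have [r [pr lr ur wr sr]] := walk_shorten graph_cycle_ge0 (tight_sub _ _ pq).
  exists (config f), r; split.
  - by exists c => //; rewrite -wp -config_token_pos.
  - split=> [|r' [pr' lr' ur']]; first by rewrite /is_path lr.
    apply: le_trans wr _.
    have [c' hc' le] := gd_below r' pr'; rewrite lr' in hc'.
    have := tight_walk_weight val_inj graph_edgesP graph_cycle_ge0 enough_graph_rounds pq.
    by rewrite lq hc' => -[<-].
  - move=> u /sr; rewrite lastI mem_rcons inE lq.
    case/predU1P=> [->|/cov[j _ /andP[_ /eqP fj]]].
      by apply/in_config; exists i.
    by apply/in_config; exists j.
have [g [cs [eT tw csE]]] := moves_tokens mv (esym config_token_pos).
have tp : path tight s p.
  have ds := rounds_source s val_inj graph_edgesP graph_cycle_ge0 enough_graph_rounds.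
  apply: (tight_of_shortest val_inj graph_edgesP graph_cycle_ge0
    enough_graph_rounds ds pp).
  have [c' hc' le] := gd_below p pp; rewrite hc' add0r; congr Some.
  apply/eqP; rewrite eq_le le /=.
  (* The distance of t is the weight of a walk, hence at least that of a path, hence at least that
     of p by minimality. *)
  have [q [pq lq <-]] := rounds_walk val_inj graph_edgesP hc'.
  have [r [pr lr ur wr _]] := walk_shorten graph_cycle_ge0 pq.
  by apply: le_trans wr; apply: mp; split; rewrite ?lr ?lq.
have [|X [q [pq lq wq _]]] := vertex_walk_complete tw tp up.
  by move=> u /sT; rewrite eT => /in_config.
have [c' hc' le] := rounds_below (s := start k s) state_edgesP
  state_cycle_ge0 enough_state_rounds pq.
exists X; rewrite /success; rewrite lq lp in hc'.
rewrite /state_dist -[state_code n X t t]/(vertex_code (X, t, Some t)) hc'.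
apply: le_trans le (le_trans _ cb); rewrite wq -csE.
(* The tokens outside X contribute nonnegative costs. *)
rewrite [leRHS](bigID (fun i : 'I_k => bit X i)) /=.
rewrite lerDl; apply: sumr_ge0 => i _; have [r [pr _ <-]] := tw i.
elim: r (token_pos i) pr => [|y r IH] x /=; first by rewrite path_weight_nil.
by case/andP=> /Mgraph_weight_ge0 h /IH; rewrite path_weight_cons; apply: addr_ge0.
Qed.

End Answer.

(** * The program *)

Lemma nth_flatten_const (T : Type) (x0 : T) c (ss : seq (seq T)) i j :
  all (fun s => size s == c) ss -> (j < c)%N ->
  nth x0 (flatten ss) (i * c + j) = nth x0 (nth [::] ss i) j.
Proof.
elim: ss i => [|s ss IH] [|i] /=; rewrite ?nth_nil //.
  by case/andP=> /eqP sc _ jc; rewrite nth_cat sc jc.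
case/andP=> /eqP sc /IH h jc; rewrite nth_cat sc mulSn -addnA ltnNge leq_addr /=.
by rewrite addKn h.
Qed.

Lemma nth_encode_graph n (G : wdigraph n) (u v : 'I_n) c : (c < 2)%N ->
  nth 0 (encode_graph G) ((u * n + v) * 2 + c) =
  nth 0 (if edge G u v then [:: 1; weight G u v] else [:: 0; 0]) c.
Proof.
move=> hc; rewrite /encode_graph nth_flatten_const //; last first.
  by apply/allP => l /allpairsP[[x y] [_ _ ->]]; case: ifP.
rewrite nth_flatten_const //; last first.
  by apply/allP => l /mapP[x _ ->]; rewrite size_map size_enum_ord.
rewrite (nth_map u) ?size_enum_ord // (nth_map v) ?size_enum_ord //.
by rewrite !nth_ord_enum.
Qed.

Lemma size_flatten_const (T : Type) c (ss : seq (seq T)) :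
  all (fun s => size s == c) ss -> size (flatten ss) = (size ss * c)%N.
Proof.
by elim: ss => //= s ss IH /andP[/eqP sc /IH h]; rewrite size_cat sc h mulSn.
Qed.

Lemma size_encode_graph n (G : wdigraph n) : size (encode_graph G) = (n * n * 2)%N.
Proof.
rewrite /encode_graph (@size_flatten_const _ 2) ?size_allpairs ?size_enum_ord //.
by apply/allP => l /allpairsP[[x y] [_ _ ->]]; case: ifP.
Qed.

Lemma foldl_relax_copies D L m :
  foldl relax D (flatten [seq L | _ <- enum 'I_m]) =
  iter m (fun D => foldl relax D L) D.
Proof.
rewrite -[m in RHS](size_enum_ord m); elim: (enum 'I_m) D => //= _ s IH D.
by rewrite foldl_cat IH -iterSr.
Qed.

(** Cell 0 holds the length of the input, so the five header integers occupy cells 1 to 5, the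
    tokens start at 6, and the graphs at 6 + k. *)
Definition NVertices : expr := Get (Nat 1).
Definition Source : expr := Get (Nat 2).
Definition Target : expr := Get (Nat 3).
Definition Budget : expr := Get (Nat 4).
Definition NTokens : expr := Get (Nat 5).
Definition Token (i : expr) : expr := Get (Add (Nat 6) i).
Definition GraphCell (c : nat) (u v : expr) : expr :=
  Get (Add (Add (Nat 6) NTokens)
           (Add (Mul (Add (Mul u NVertices) v) (Nat 2)) (Nat c))).
Definition MoveCell (c : nat) (u v : expr) : expr :=
  Get (Add (Add (Add (Nat 6) NTokens) (Mul (Mul NVertices NVertices) (Nat 2)))
           (Add (Mul (Add (Mul u NVertices) v) (Nat 2)) (Nat c))).
Definition GraphWeight (b : bool) (u v : expr) : expr :=
  if b then GraphCell 1 u v else Cst 0.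
Definition StateCode (X v a : expr) : expr :=
  Add (Mul (Add (Mul X NVertices) v) (Add NVertices (Nat 1))) a.

Definition power_cmd : cmd :=
  Seq (SetVar 0 (Nat 1)) (For 1 NTokens (SetVar 0 (Add (Var 0) (Var 0)))).

Definition graph_cmd (b : bool) : cmd :=
  Seq (SetEntry false Source (Cst 0))
  (For 1 NVertices (For 2 NVertices (For 3 NVertices
    (If (GraphCell 0 (Var 2) (Var 3))
        (Relax false (Var 2) (Var 3) (GraphWeight b (Var 2) (Var 3)))
        Skip)))).

(** The product of an edge entry and two flags is a conjunction; distances are read only when both
    are present. *)
Definition move_cmd (b : bool) : cmd :=
  For 2 (Var 0) (For 3 NVertices
    (Seq
      (For 4 NVertices (For 5 NVertices
        (If (MoveCell 0 (Var 4) (Var 5))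
            (Relax true (StateCode (Var 2) (Var 3) (Var 4))
                        (StateCode (Var 2) (Var 3) (Var 5))
                        (MoveCell 1 (Var 4) (Var 5)))
            Skip)))
      (For 4 NVertices
        (If (Mul (Mul (GraphCell 0 (Var 3) (Var 4)) (Flag false (Var 3)))
                 (Flag false (Var 4)))
            (If (Sub (Add (Value false (Var 3)) (GraphWeight b (Var 3) (Var 4)))
                     (Value false (Var 4)))
                Skip
                (Relax true (StateCode (Var 2) (Var 3) (Var 3))
                            (StateCode (Var 2) (Var 4) NVertices)
                            (Cst 0)))
            Skip)))).

(* Var 2 runs through the powers 2^i: the masks X without bit i are the       *)
(* numbers hi 2^(i+1) + lo with lo < 2^i.                                     *)
Definition pick_cmd : cmd :=
  let X := Add (Mul (Var 4) (Add (Var 2) (Var 2))) (Var 5) in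
  Seq (SetVar 2 (Nat 1))
  (For 3 NTokens
    (Seq
      (For 4 (Var 0) (For 5 (Var 2)
        (If (Sub (Var 0) (Add X (Var 2)))
            (For 6 NVertices
              (Relax true (StateCode X (Var 6) NVertices)
                          (StateCode (Add X (Var 2)) (Var 6) (Token (Var 3)))
                          (Cst 0)))
            Skip)))
      (SetVar 2 (Add (Var 2) (Var 2))))).

Definition state_cmd (b : bool) : cmd :=
  Seq (SetEntry true (StateCode (Nat 0) Source NVertices) (Cst 0))
  (For 1 (Mul (Mul (Var 0) NVertices) (Add NVertices (Nat 1)))
    (Seq (move_cmd b) pick_cmd)).

Definition answer_cmd : cmd :=
  let X := StateCode (Var 2) Target Target in
  Seq (SetVar 1 (Nat 0))
  (Seq (For 2 (Var 0)
         (If (Flag true X)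
             (If (Sub (Value true X) Budget) Skip (SetVar 1 (Nat 1)))
             Skip))
       (Assign (Nat 0) (Var 1))).

Definition program (b : bool) : cmd :=
  Seq power_cmd (Seq (graph_cmd b) (Seq (state_cmd b) answer_cmd)).

(** * Verification of the program on an encoded instance *)

Section Program.
Variables (b : bool) (I : instance) (B : nat).
Let n := nvertices I.
Let k := ntokens I.
Let M := Mgraph I.
Let G := reweight b (Ggraph I).
Let inp := encode_instance I.
Hypothesis rounds_leB : (2 ^ k * n * n.+1 <= B)%N.
Hypothesis ntokens_leB : (k <= B)%N.

Lemma nvertices_gt0 : (0 < n)%N.
Proof. exact: leq_ltn_trans (ltn_ord (source I)). Qed.

Lemma nvertices_leB : (n <= B)%N.
Proof.
apply: leq_trans rounds_leB; have := nvertices_gt0.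
have : (0 < 2 ^ k)%N by rewrite expn_gt0.
nia.
Qed.

Lemma masks_leB : (2 ^ k <= B)%N.
Proof. by apply: leq_trans rounds_leB; have := nvertices_gt0; nia. Qed.

Lemma load_token (i : 'I_k) : load inp (6 + i)%N = (token_pos i : nat).
Proof.
rewrite /load /inp /encode_instance /= nth_cat size_map ltn_ord.
rewrite (nth_map (source I)) ?ltn_ord // /token_pos.
by rewrite (tnth_nth (source I)).
Qed.

Lemma load_graph (u v : 'I_n) c : (c < 2)%N ->
  load inp (6 + k + ((u * n + v) * 2 + c))%N =
  nth 0 (if edge (Ggraph I) u v then [:: 1; weight (Ggraph I) u v] else [:: 0; 0]) c.
Proof.
move=> hc; rewrite -nth_encode_graph // /load /inp /encode_instance -addnA /=.
rewrite nth_cat size_map -[size _]/k add0n ltnNge leq_addr /= addKn.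
rewrite nth_cat size_encode_graph.
have -> // : ((u * n + v) * 2 + c < n * n * 2)%N.
have := ltn_ord u; have := ltn_ord v; nia.
Qed.

Lemma load_move (u v : 'I_n) c : (c < 2)%N ->
  load inp (6 + k + n * n * 2 + ((u * n + v) * 2 + c))%N =
  nth 0 (if edge M u v then [:: 1; weight M u v] else [:: 0; 0]) c.
Proof.
move=> hc; rewrite -nth_encode_graph // /load /inp /encode_instance -!addnA /=.
rewrite nth_cat size_map -[size _]/k add0n ltnNge leq_addr /= addKn.
rewrite nth_cat size_encode_graph.
by rewrite ltnNge leq_addr /= addKn.
Qed.

Section Evaluation.
Variable s : state.
Local Notation evals := (evals inp s).

Lemma evals_nvertices : evals NVertices n. 
Proof. exact: (@evals_input inp s _ 1 (@evals_nat inp s 1)). Qed.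
Lemma evals_source : evals Source (source I : nat). 
Proof. exact: (@evals_input inp s _ 2 (@evals_nat inp s 2)). Qed.
Lemma evals_target : evals Target (target I : nat). 
Proof. exact: (@evals_input inp s _ 3 (@evals_nat inp s 3)). Qed.
Lemma evals_budget : evals Budget (budget I). 
Proof. exact: (@evals_input inp s _ 4 (@evals_nat inp s 4)). Qed.
Lemma evals_ntokens : evals NTokens k. 
Proof. exact: (@evals_input inp s _ 5 (@evals_nat inp s 5)). Qed.

Lemma evals_token e (i : 'I_k) : evals e (i : nat) -> evals (Token e) (token_pos i : nat).
Proof.
by move=> h; rewrite -load_token; apply: evals_input; apply: evals_addn.
Qed.

Lemma evals_graph_cell c eu ev (u v : 'I_n) : (c < 2)%N ->
  evals eu (u : nat) -> evals ev (v : nat) ->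
  evals (GraphCell c eu ev)
    (nth 0 (if edge (Ggraph I) u v then [:: 1; weight (Ggraph I) u v] else [:: 0; 0]) c).
Proof.
move=> hc hu hv; rewrite -load_graph //; apply: evals_input.
have hn := evals_nvertices; have hk := evals_ntokens.
by do ?[apply: evals_addn | apply: evals_muln | apply: evals_nat].
Qed.

Lemma evals_move_cell c eu ev (u v : 'I_n) : (c < 2)%N ->
  evals eu (u : nat) -> evals ev (v : nat) ->
  evals (MoveCell c eu ev)
    (nth 0 (if edge M u v then [:: 1; weight M u v] else [:: 0; 0]) c).
Proof.
move=> hc hu hv; rewrite -load_move //; apply: evals_input.
have hn := evals_nvertices; have hk := evals_ntokens.
by do ?[apply: evals_addn | apply: evals_muln | apply: evals_nat].
Qed.

Lemma evals_graph_edge eu ev (u v : 'I_n) :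
  evals eu (u : nat) -> evals ev (v : nat) ->
  evals (GraphCell 0 eu ev) (edge G u v : nat).
Proof.
move=> hu hv; rewrite /G edge_reweight.
by have := @evals_graph_cell 0 _ _ _ _ isT hu hv; case: ifP.
Qed.

Lemma evals_graph_weight eu ev (u v : 'I_n) : edge G u v ->
  evals eu (u : nat) -> evals ev (v : nat) ->
  evals (GraphWeight b eu ev) (weight G u v).
Proof.
rewrite /G edge_reweight /GraphWeight => uv hu hv; case: (b) => //.
by have := @evals_graph_cell 1 _ _ _ _ isT hu hv; rewrite uv.
Qed.

Lemma evals_move_edge eu ev (u v : 'I_n) :
  evals eu (u : nat) -> evals ev (v : nat) ->
  evals (MoveCell 0 eu ev) (edge M u v : nat).
Proof.
move=> hu hv.
by have := @evals_move_cell 0 _ _ _ _ isT hu hv; case: ifP.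
Qed.

Lemma evals_move_weight eu ev (u v : 'I_n) : edge M u v ->
  evals eu (u : nat) -> evals ev (v : nat) ->
  evals (MoveCell 1 eu ev) (weight M u v).
Proof.
move=> uv hu hv.
by have := @evals_move_cell 1 _ _ _ _ isT hu hv; rewrite uv.
Qed.

Lemma evals_state_code eX ev ea (X v a : nat) :
  evals eX X -> evals ev v -> evals ea a ->
  evals (StateCode eX ev ea) (state_code n X v a).
Proof.
move=> hX hv ha; rewrite /state_code -[n.+1]addn1; have hn := evals_nvertices.
by do ?[apply: evals_addn | apply: evals_muln | apply: evals_nat].
Qed.

End Evaluation.

Lemma evals_var_nat (vs : seq int) A j (z : nat) : (j < size vs)%N -> vs`_j = z%:Z ->
  evals inp (State vs A) (Var j) z.
Proof. by move=> h <-; apply: evals_var. Qed.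

Ltac ev := first
  [ exact: evals_nvertices | exact: evals_source | exact: evals_target
  | exact: evals_budget | exact: evals_ntokens | exact: evals_nat
  | exact: evals_cst
  | exact: evals_var_nat
  | apply: evals_state_code; ev
  | apply: evals_token; ev
  | apply: evals_addn; ev | apply: evals_muln; ev ].

Definition none : entries := fun=> None.
(** Array [false] holds the distances in G, array [true] those in the state graph. *)
Definition dists (D E : entries) : bool -> entries :=
  fun q => if q then E else D.

Lemma models_dists vs q D O m :
  models inp (State vs (focus q D O)) m <->
  models inp (State vs (if q then dists O D else dists D O)) m.
Proof. by split; apply: models_eq_arr; case: q => -[]. Qed.

Lemma triple_power A : triple inp B (State [::] A) power_cmd
  (State [:: (2 ^ k)%N%:Z] A).
Proof.
apply: (@triple_seq _ _ _ (State [:: 1] A)).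
  by apply: (@triple_newvar _ _ [::]); ev.
apply: (@triple_for _ _ (fun i => [:: (2 ^ i)%N%:Z]) (fun=> A)) => //.
  by move=> i _; ev.
move=> i _ /=.
have -> : [:: (2 ^ i.+1)%N%:Z; i%:Z] = set_nth 0 [:: (2 ^ i)%N%:Z; i%:Z] 0 (2 ^ i.+1)%N.
  by [].
by apply: triple_setvar => //; rewrite expnS mul2n -addnn; ev.
Qed.

Lemma triple_graph K : triple inp B
  (State [:: K] (dists none none)) (graph_cmd b)
  (State [:: K] (dists (graph_dist b I) none)).
Proof.
apply: (@triple_conseq _ _ (State [:: K] (focus false none none))
  (State [:: K] (focus false (graph_dist b I) none))).
- by move=> m h; apply/models_dists.
- by move=> m /models_dists.
apply: triple_seq.
  by apply: (@triple_setentry _ _ _ _ _ _ _ _ (source I)) => [D|]; ev.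
have := @relaxes_for_const inp B false none [:: K] 1 NVertices
  (For 2 NVertices (For 3 NVertices
    (If (GraphCell 0 (Var 2) (Var 3))
        (Relax false (Var 2) (Var 3) (GraphWeight b (Var 2) (Var 3)))
        Skip))) n (fun=> graph_edges b I) nvertices_leB erefl.
move=> h; have {}h := h _ _ (update none (source I) 0).
rewrite foldl_relax_copies in h; apply: h; first by move=> i D; ev.
move=> r; apply: relaxes_for_const => //; first exact: nvertices_leB.
  by move=> i D; ev.
move=> u; apply: relaxes_for_const => //; first exact: nvertices_leB.
  by move=> i D; ev.
move=> v.
apply: (@relaxes_if _ _ _ _ _ _ _ (edge G u v : nat)) => [D|uv|].
- by apply: evals_graph_edge; ev.
- have {}uv : edge G u v by case: (edge _ _ _) uv.
  rewrite uv; apply: relaxes_relax => D; try by ev.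
  by apply: evals_graph_weight => //; ev.
- by case: (edge _ _ _) => // _; apply: relaxes_skip.
Qed.

Lemma evals_flag_dist vs D eu (u : nat) :
  evals inp (State vs (focus true D (graph_dist b I))) eu u ->
  evals inp (State vs (focus true D (graph_dist b I))) (Flag false eu)
    (isSome (graph_dist b I u) : nat).
Proof. exact: evals_flag. Qed.

Lemma evals_value_dist vs D eu (u : nat) c : graph_dist b I u = Some c ->
  evals inp (State vs (focus true D (graph_dist b I))) eu u ->
  evals inp (State vs (focus true D (graph_dist b I))) (Value false eu) c.
Proof. by move=> h hu; apply: evals_value hu _. Qed.

Lemma relaxes_move r : relaxes inp B true (graph_dist b I)
  [:: (2 ^ k)%N%:Z; r] (move_cmd b) [:: (2 ^ k)%N%:Z; r] (move_edges b I).
Proof.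
apply: relaxes_for_const => //; [exact: masks_leB | by move=> i D; ev |].
move=> X; apply: relaxes_for_const => //; [exact: nvertices_leB | by move=> i D; ev |].
move=> v; apply: relaxes_seq.
  apply: relaxes_for_const => //; [exact: nvertices_leB | by move=> i D; ev |].
  move=> x; apply: relaxes_for_const => //; [exact: nvertices_leB | by move=> i D; ev |].
  move=> y; apply: (@relaxes_if _ _ _ _ _ _ _ (edge M x y : nat)) => [D|xy|].
  - by apply: evals_move_edge; ev.
  - have {}xy : edge M x y by case: (edge _ _ _) xy.
    rewrite xy; apply: relaxes_relax => D; try by ev.
    by apply: evals_move_weight => //; ev.
  - by case: (edge _ _ _) => // _; apply: relaxes_skip.
apply: relaxes_for_const => //; [exact: nvertices_leB | by move=> i D; ev |].
move=> u; apply: (@relaxes_if _ _ _ _ _ _ _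
    (edge G v u * isSome (graph_dist b I v) * isSome (graph_dist b I u))%N).
- move=> D; apply: evals_muln; last by apply: evals_flag_dist; ev.
  apply: evals_muln; last by apply: evals_flag_dist; ev.
  by apply: evals_graph_edge; ev.
- rewrite /tight /tight_edge -/(graph_dist b I).
  case vu: (edge _ _ _) => //; case Ev: (graph_dist b I v) => [c|] //.
  case Eu: (graph_dist b I u) => [c'|] // _.
  apply: (@relaxes_if _ _ _ _ _ _ _ (c + weight G v u - c')) => [D||].
  + apply: evals_sub; last by apply: evals_value_dist Eu _; ev.
    apply: evals_add; first by apply: evals_value_dist Ev _; ev.
    by apply: evals_graph_weight => //; ev.
  + by rewrite subr_gt0 ltNge => /negbTE ->; apply: relaxes_skip.
  + by rewrite subr_le0 => ->; apply: relaxes_relax => D; ev.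
- rewrite /tight /tight_edge -/(graph_dist b I).
  case: (edge _ _ _) => [|_]; last exact: relaxes_skip.
  case: (graph_dist b I v) => [c|_]; last exact: relaxes_skip.
  by case: (graph_dist b I u) => [c'|_] //; apply: relaxes_skip.
Qed.

Lemma relaxes_pick r : relaxes inp B true (graph_dist b I)
  [:: (2 ^ k)%N%:Z; r] pick_cmd [:: (2 ^ k)%N%:Z; r] (pick_edges I).
Proof.
(* The loop leaves 2^k in variable 2, which is then forgotten. *)
apply: (@relaxes_drop _ _ _ _ _ _ (2 ^ k)%N%:Z); rewrite /= -[pick_edges I]cat0s.
apply: (@relaxes_seq _ _ _ _ _ [:: (2 ^ k)%N%:Z; r; 1]).
  by apply: (@relaxes_setvar _ _ _ _ [:: (2 ^ k)%N%:Z; r] 2) => // D; ev.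
apply: (@relaxes_for _ _ _ _ (fun i => [:: (2 ^ k)%N%:Z; r; (2 ^ i)%N%:Z])) => //.
  by move=> i D; ev.
move=> i; rewrite -[flatten _]cats0; apply: relaxes_seq; last first.
  have := @relaxes_setvar inp B true (graph_dist b I)
    [:: (2 ^ k)%N%:Z; r; (2 ^ i)%N%:Z; (i : nat)%:Z] 2
    (Add (Var 2) (Var 2)) (2 ^ i.+1)%N isT; apply.
  by move=> D; rewrite expnS mul2n -addnn; ev.
apply: relaxes_for_const => //; [exact: masks_leB | by move=> j D; ev |].
move=> hi; apply: relaxes_for_const => //; [| by move=> j D; ev |].
  by apply: leq_trans masks_leB; rewrite leq_exp2l // ltnW.
move=> lo.
have evX (j : seq int) D : evals inp
    (State ([:: (2 ^ k)%N%:Z; r; (2 ^ i)%N%:Z; (i : nat)%:Z; (hi : nat)%:Z;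
             (lo : nat)%:Z] ++ j) D)
    (Add (Mul (Var 4) (Add (Var 2) (Var 2))) (Var 5)) (hi * 2 ^ i.+1 + lo)%N.
  by rewrite expnS mul2n -addnn; ev.
have evY (j : seq int) D : evals inp
    (State ([:: (2 ^ k)%N%:Z; r; (2 ^ i)%N%:Z; (i : nat)%:Z; (hi : nat)%:Z;
             (lo : nat)%:Z] ++ j) D)
    (Add (Add (Mul (Var 4) (Add (Var 2) (Var 2))) (Var 5)) (Var 2))
    (hi * 2 ^ i.+1 + lo + 2 ^ i)%N.
  by apply: evals_addn (evX _ _) _; ev.
apply: (@relaxes_if _ _ _ _ _ _ _
  ((2 ^ k)%N%:Z - (hi * 2 ^ i.+1 + lo + 2 ^ i)%N%:Z)) => [D||].
- by apply: evals_sub; [ev | exact: (evY [::])].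
- rewrite subr_gt0 ltz_nat => ->.
  apply: relaxes_for_const => //; [exact: nvertices_leB | by move=> j D; ev |].
  move=> v; apply: relaxes_relax => D; last by ev.
    by apply: evals_state_code; [exact: (evX [:: _]) | ev | ev].
  by apply: evals_state_code; [exact: (evY [:: _]) | ev | ev].
- by rewrite subr_le0 lez_nat leqNgt => /negbTE ->; apply: relaxes_skip.
Qed.

Lemma triple_state : triple inp B
  (State [:: (2 ^ k)%N%:Z] (dists (graph_dist b I) none)) (state_cmd b)
  (State [:: (2 ^ k)%N%:Z] (dists (graph_dist b I) (state_dist b I))).
Proof.
apply: (@triple_conseq _ _
  (State [:: (2 ^ k)%N%:Z] (focus true none (graph_dist b I)))
  (State [:: (2 ^ k)%N%:Z] (focus true (state_dist b I) (graph_dist b I)))).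
- by move=> m h; apply/models_dists.
- by move=> m /models_dists.
apply: triple_seq.
  by apply: (@triple_setentry _ _ _ _ _ _ _ _ (state_code n 0 (source I) n)) => [D|]; ev.
have h := @relaxes_for_const inp B true (graph_dist b I) [:: (2 ^ k)%N%:Z] 1
  (Mul (Mul (Var 0) NVertices) (Add NVertices (Nat 1))) (Seq (move_cmd b) pick_cmd)
  (2 ^ k * n * n.+1) (fun=> state_edges b I) rounds_leB erefl.
have {h} := h _ _ (update none (state_code n 0 (source I) n) 0).
rewrite foldl_relax_copies; apply; first by move=> i D; rewrite -[n.+1]addn1; ev.
by move=> r; apply: relaxes_seq; [exact: relaxes_move | exact: relaxes_pick].
Qed.

(** Not a triple: the last assignment overwrites cell 0, which belongs to the input, so no state is
    modelled afterwards. *)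
Lemma uexec_answer m : models inp
    (State [:: (2 ^ k)%N%:Z] (dists (graph_dist b I) (state_dist b I))) m ->
  exists m' N, [/\ uexec answer_cmd m m' N, (N <= step_bound B answer_cmd)%N
                 & m' 0 = (answer b I : nat)%:Z].
Proof.
set A := dists _ _; move=> hm.
pose ans i := has (success b I) (iota 0 i).
have h : triple inp B (State [:: (2 ^ k)%N%:Z; 0] A)
    (For 2 (Var 0)
         (If (Flag true (StateCode (Var 2) Target Target))
             (If (Sub (Value true (StateCode (Var 2) Target Target)) Budget)
                 Skip (SetVar 1 (Nat 1)))
             Skip))
    (State [:: (2 ^ k)%N%:Z; (answer b I : nat)%:Z] A).
  have -> : answer b I = ans (2 ^ k)%N.
    apply/existsP/hasP => [[X sX]|[X]].
      by exists (X : nat); rewrite // mem_iota ltn_ord.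
    by rewrite mem_iota => /= lt sX; exists (Ordinal lt).
  apply: (@triple_for _ _ (fun i => [:: (2 ^ k)%N%:Z; (ans i : nat)%:Z]) (fun=> A)) => //.
  - exact: masks_leB.
  - by move=> i _; ev.
  move=> i _.
  have evX : evals inp (State [:: (2 ^ k)%N%:Z; (ans i : nat)%:Z; i%:Z] A)
      (StateCode (Var 2) Target Target) (state_code n i (target I) (target I)) by ev.
  have -> : ans i.+1 = ans i || success b I i.
    by rewrite /ans -addn1 iotaD has_cat /= orbF.
  rewrite /success; apply: triple_if; first exact: (evals_flag true evX).
    rewrite /=; case E: (state_dist _ _ _) => [c|] // _.
    apply: triple_if.
        by apply: evals_sub; [apply (@evals_value inp _ A true _ _ _ evX E) | ev].
      by rewrite subr_gt0 ltNge => /negbTE ->; rewrite orbF; apply: triple_skip.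
    rewrite subr_le0 => ->; rewrite orbT.
    by apply: (@triple_setvar _ _ [:: _; _; _] _ 1) => //; ev.
  rewrite /=; case E: (state_dist _ _ _) => [c|] // _.
  by rewrite orbF; apply: triple_skip.
have h0 : triple inp B (State [:: (2 ^ k)%N%:Z] A) (SetVar 1 (Nat 0))
    (State [:: (2 ^ k)%N%:Z; 0] A).
  by apply: (@triple_newvar _ _ [:: _]); ev.
have [m1 [N1 [r1 b1 hm1]]] := h0 m hm.
have [m2 [N2 [r2 b2 hm2]]] := h m1 hm1.
exists (store m2 0 (eval m2 (Var 1))), (N1 + (N2 + 1))%N; split.
- by apply: uexec_seq r1 (uexec_seq r2 (uexec_assign _ _ _)).
- by rewrite /= -!/(step_bound _ _); apply: leq_add b1 (leq_add b2 _).
- by rewrite /store eqxx; apply: (@evals_var_nat [:: _; _] A 1 _ isT erefl _ hm2).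
Qed.

Lemma uexec_program : exists m N,
  [/\ uexec (program b) (load inp) m N, (N <= step_bound B (program b))%N
    & m 0 = (answer b I : nat)%:Z].
Proof.
have h0 : models inp (State [::] (dists none none)) (load inp).
  by split=> //= -[].
have [m1 [N1 [r1 b1 h1]]] := triple_power h0.
have [m2 [N2 [r2 b2 h2]]] := triple_graph h1.
have [m3 [N3 [r3 b3 h3]]] := triple_state h2.
have [m4 [N4 [r4 b4 e]]] := uexec_answer h3.
exists m4, (N1 + (N2 + (N3 + N4)))%N; split=> //.
- exact: uexec_seq r1 (uexec_seq r2 (uexec_seq r3 r4)).
- exact: leq_add b1 (leq_add b2 (leq_add b3 b4)).
Qed.

End Program.

(** * Fixed-parameter tractability *)

(** Cell 1 initially holds k and counts down, while cell 0 accumulates the product. *)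
Lemma computable_geometric C D : computable (fun k => (C * D ^ k)%N).
Proof.
pose body := Seq (Assign (Nat 0) (Mul (Get (Nat 0)) (Nat D)))
                 (Assign (Nat 1) (Sub (Get (Nat 1)) (Nat 1))).
have loop (k : nat) (m : memory) : m 1 = k -> exists m' t,
    exec (While (Get (Nat 1)) body) m m' t /\ m' 0 = m 0 * (D ^ k)%N%:Z.
  elim: k m => [|k IH] m mk.
    exists m, (cost m (Get (Nat 1))).+1; split; last by rewrite expn0 mulr1.
    by apply: exec_while_false; rewrite /= mk.
  pose m1 := store m 0 (m 0 * D); pose m2 := store m1 1 (m1 1 - 1).
  have [|m' [t [r e]]] := IH m2; first by rewrite /m2 /m1 /store /= mk; lia.
  exists m'; eexists; split.
    apply: exec_while_true r; first by rewrite /= mk.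
    exact: exec_seq (exec_assign m (Nat 0) (Mul (Get (Nat 0)) (Nat D)))
                    (exec_assign m1 (Nat 1) (Sub (Get (Nat 1)) (Nat 1))).
  by rewrite e /m2 /m1 /store /= expnS PoszM mulrA.
exists (Seq (Assign (Nat 0) (Nat C)) (While (Get (Nat 1)) body)) => k.
have [//|m' [t [r e]]] := loop k (store (load [:: k%:Z]) 0 C).
exists m'; eexists; split; first exact: exec_seq (exec_assign _ (Nat 0) (Nat C)) r.
by rewrite e PoszM.
Qed.

Lemma size_leq_input_size x : (size x <= input_size x)%N.
Proof.
rewrite /input_size -sum1_size; apply: leq_sum => z _; exact: bitlen_gt0.
Qed.

Lemma bounded_load x : bounded (input_size x).+1 (load x).
Proof.
case=> [[|i]|i] //=.
  by apply: leq_trans (bitlen_nat _) _; rewrite ltnS size_leq_input_size.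
have [lt|ge] := ltnP i (size x); last by rewrite nth_default.
apply: leqW; rewrite /input_size (big_nth 0) big_mkord.
by rewrite (bigD1 (Ordinal lt)) //= leq_addr.
Qed.

Lemma clinear_program b : clinear (program b).
Proof. by case: b. Qed.

Lemma ntokens_leq_input_size I : (ntokens I <= input_size (encode_instance I))%N.
Proof.
apply: leq_trans (size_leq_input_size _).
rewrite /encode_instance !size_cat size_map -[size (tokens I)]/(ntokens I) /=.
lia.
Qed.

Lemma graph_leq_input_size I :
  (nvertices I * (nvertices I).+1 <= input_size (encode_instance I))%N.
Proof.
apply: leq_trans (size_leq_input_size _).
rewrite /encode_instance !size_cat size_map !size_encode_graph /=.
have := nvertices_gt0 I; nia.
Qed.

Lemma fpt_answer b (Y : instance -> Prop) :
  (forall I, reflect (Y I) (answer b I)) ->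
  fpt (ParamProblem encode_instance ntokens Y).
Proof.
move=> hY; set c := program b; set e := depth c; set S := cmd_size c.
set A := csize c.
exists c, (fun k => S * (A.+1 * (2 + A * S)) * (2 ^ (2 * e).+1) ^ k)%N, (2 * e).+1.
split; first exact: computable_geometric.
move=> I; set x := encode_instance I; set Z := input_size x; set k := ntokens I.
(* A common bound on the iterations of all loops, as n (n + 1) <= Z and k <= Z. *)
set X := (2 ^ k * Z)%N.
have Zk : (k <= Z)%N := ntokens_leq_input_size I.
have Zn : (nvertices I * (nvertices I).+1 <= Z)%N := graph_leq_input_size I.
have k0 : (0 < 2 ^ k)%N by rewrite expn_gt0.
have Z0 : (0 < Z)%N by apply: leq_trans Zn; rewrite muln_gt0 nvertices_gt0.
have X0 : (0 < X)%N by rewrite muln_gt0 k0.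
have ZX : (Z <= X)%N by rewrite leq_pmull.
have [||m [N [r hN m0]]] := @uexec_program b I X.
- by rewrite -mulnA leq_mul.
- exact: leq_trans ZX.
have [_ [t rt ht]] := uexec_exec r (clinear_program b) (leqnn _) (ltn0Sn _)
  (@bounded_load x).
exists m, t; split=> //.
- by rewrite m0 => /hY ->.
- by rewrite m0; case: hY.
have {}hN : (N <= S * X ^ e)%N by apply: leq_trans hN (step_bound_leq _ X0).
apply: leq_trans ht _; rewrite -/A -/Z.
(* Here Z + 2, or less, is absorbed as Z + 1 <= 2 X, and the number of steps is at most S X^e. *)
apply: (@leq_trans (S * X ^ e * (A.+1 * ((2 + A * S) * X ^ e.+1)))%N).
  apply: (leq_mul hN); apply: leq_mul => //; rewrite mulnDl; apply: leq_add.
    rewrite expnS; have : (0 < X ^ e)%N by rewrite expn_gt0 X0.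
    nia.
  rewrite -mulnA; apply: leq_mul => //; apply: leq_trans hN _.
  by rewrite leq_mul // leq_pexp2l.
rewrite /= -/k -/x -/Z -expnM -[(_ * 2 ^ _ * _)%N]mulnA.
(* The powers of X total 2 e + 1, and X = 2^k Z separates the parameter from the input size. *)
have -> : (2 ^ ((2 * e).+1 * k) * Z ^ (2 * e).+1 = X ^ e * X ^ e.+1)%N.
  by rewrite -expnD addnS addnn -mul2n expnMn -expnM [(k * _)%N]mulnC.
by apply: eq_leq; ring.
Qed.

Theorem theorem2 : fpt path_discovery /\ fpt shortest_path_discovery.
Proof.
split.
  apply: (@fpt_answer false) => I.
  apply: (iffP (answerP false I)) => -[T [p [rT sp sT]]]; exists T, p; split=> //.
    by case: sp.
  by split=> // q _; rewrite !walk_weight_unweighted.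
by apply: (@fpt_answer true) => I; apply: (answerP true I).
Qed.
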